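(* Let $\phi:\mathbb{R}\to\mathbb{R}$ be globally Lipschitz continuous. Let $1<p,q<+\infty$ with $\frac1p+\frac1q=1$. Then for any real-valued $f\in L^p(\mathbb{R})\cap L^1(\mathbb{R})$ with $\phi f\in L^q(\mathbb{R})$, $$\int_{-\infty}^{+\infty}\phi(x)f(x)\,Hf(x)\,dx=\frac{1}{2\pi}\int_{-\infty}^{+\infty}\int_{-\infty}^{+\infty}\frac{\phi(x)-\phi(y)}{x-y}\,f(x)f(y)\,dx\,dy .$$
   Context: $H$ denotes the Hilbert transform on $\mathbb{R}$: $(Hf)(x)=\frac{1}{\pi}\,\mathrm{P.V.}\int_{-\infty}^{\infty}\frac{f(y)}{x-y}\,dy$. *)

(* Defs.v *)
From HB Require Import structures.
From mathcomp Require Import all_boot all_order all_algebra.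
From mathcomp Require Import all_classical all_reals all_analysis.

Set Implicit Arguments.
Unset Strict Implicit.
Unset Printing Implicit Defensive.
Import Order.TTheory GRing.Theory Num.Theory.
Import numFieldNormedType.Exports.

Local Open Scope classical_set_scope.
Local Open Scope ring_scope.

(* Principal value at the singularity x, which is cut out symmetrically. There
   is no cut-off at infinity: in [hilbert], for f in L^r with 1 <= r < +oo, the
   integrand is Lebesgue integrable away from x.
   Where the limit does not exist, [lim] returns a default value; for the
   Hilbert transform of such an f this concerns a null set of x only. *)
Definition pv_integral (R : realType) (g : R -> R) (x : R) : R :=
  lim ((\int[lebesgue_measure]_(y in [set y | e < `|x - y|]) g y)
       @[e --> 0^'+]).

Definition hilbert (R : realType) (f : R -> R) (x : R) : R :=
  pi^-1 * pv_integral (fun y => f y / (x - y)) x.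

(* Main.v *)
(* Write psi = sqrt |phi| and g = psi f. Young's inequality gives |phi| f^2 in L^1, that is
   g in L^2. Since psi(x) |psi(x) - psi(y)| <= ||phi(x)| - |phi(y)|| <= L |x - y|, the product
   phi Hf differs from (phi / psi) Hg by an absolutely convergent commutator integral, so only
   the L^2 theory of H is needed.

   That theory comes from the kernels q_s(z) = z / (z^2 + s^2) and p_s(z) = s / (z^2 + s^2).
   The identity q_s * q_t - p_s * p_t = - 2 pi p_(s+t) bounds the L^2 norm of (q_s - q_t) * g by
   second differences of F(s) = <g, p_s * g>. Hence F is midpoint convex; being bounded, it is
   monotone and converges at 0 and at infinity, so (q_(1/n) - q_n) * g converges in L^2 to some
   h. From p_s * q_t = pi q_(s+t) one gets p_s * h = pi (q_s * g), so q_s * g tends to h at every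
   Lebesgue point of h. At Lebesgue points of f the truncated singular integral differs from
   q_e * f by o(1), because its kernel differs from q_e by an odd function dominated by p_e.

   With the odd integrable kernel q_(1/n) - q_n in place of 1 / (x - y), the formula is Fubini's
   theorem and the exchange of x and y; both sides pass to the limit. *)

From HB Require Import structures.
Require Import Defs.
From mathcomp Require Import all_boot all_order all_algebra.
From mathcomp Require Import all_classical all_reals all_analysis.
From mathcomp Require Import measurable_realfun ring lra.

Import Order.TTheory GRing.Theory Num.Theory.
Import numFieldNormedType.Exports.

Set Implicit Arguments.
Unset Strict Implicit.
Unset Printing Implicit Defensive.

Local Open Scope classical_set_scope.
Local Open Scope ring_scope.

(** * Integration of real-valued functions *)

(** The convolution identities stand in for Plancherel's theorem. With the multipliers pi e^(-s|xi|)
    for p_s and - i pi sgn(xi) e^(-s|xi|) for q_s, F(s) is the integral of e^(-s|xi|) against a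
    multiple of |hat g|^2, and its second difference is that of (e^(-s|xi|) - e^(-t|xi|))^2. This
    explains the convexity and the limits, but no Fourier transform occurs below: the identities
    come from partial fractions and explicit primitives. Two obstacles shape the rest. [phi] may
    change sign, so it is factored as [gam * psi] with [|gam| = psi], which makes both [psi f] and
    [gam f] square integrable. And h is a mean-square limit along smooth kernels, not a principal
    value: the two are compared almost everywhere by dividing by [phi], and where [phi] vanishes the
    integrand is zero anyway. *)

Section real_integrals.
Context d (T : measurableType d) (R : realType).
Variable mu : {measure set T -> \bar R}.
Implicit Types f g : T -> R.

(** A real integral is the [fine] of an extended one, which sends infinite values to 0;
    integrability therefore has to be carried along separately. *)
Definition Rintegrable f := mu.-integrable setT (EFin \o f).

Lemma Rintegrable_measurable f : Rintegrable f -> measurable_fun setT f.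
Proof. by move=> /measurable_int/measurable_EFinP. Qed.

Lemma Rintegrable_le f g : measurable_fun setT f ->
  (forall x, `|f x| <= g x) -> Rintegrable g -> Rintegrable f.
Proof.
move=> mf fg; apply: le_integrable => //; first exact/measurable_EFinP.
by move=> x _ /=; rewrite lee_fin (le_trans (fg x))// ler_norm.
Qed.

Lemma eq_Rintegrable f g : f =1 g -> Rintegrable f -> Rintegrable g.
Proof. by move=> /funext ->. Qed.

Lemma RintegrableD f g :
  Rintegrable f -> Rintegrable g -> Rintegrable (fun x => f x + g x).
Proof. exact: integrableD. Qed.

Lemma RintegrableB f g :
  Rintegrable f -> Rintegrable g -> Rintegrable (fun x => f x - g x).
Proof. exact: integrableB. Qed.

Lemma RintegrableZl k f : Rintegrable f -> Rintegrable (fun x => k * f x).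
Proof. exact: integrableZl. Qed.

Lemma RintegrableZr k f : Rintegrable f -> Rintegrable (fun x => f x * k).
Proof.
by move=> /(RintegrableZl k); apply: eq_Rintegrable => x; rewrite mulrC.
Qed.

Lemma Rintegrable_norm f : Rintegrable f -> Rintegrable (fun x => `|f x|).
Proof. exact: integrable_norm. Qed.

Lemma Rintegral_EFin f : Rintegrable f ->
  (\int[mu]_x (f x)%:E = (\int[mu]_x f x)%:E)%E.
Proof.
by move=> jf; rewrite /Rintegral fineK//; exact: integrable_fin_num jf.
Qed.

Lemma ge0_Rintegrable f M : measurable_fun setT f -> (forall x, 0 <= f x) ->
  (\int[mu]_x (f x)%:E <= M%:E)%E -> Rintegrable f /\ \int[mu]_x f x <= M.
Proof.
move=> mf f0 fM.
have jf : Rintegrable f.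
  apply/integrableP; split; first exact/measurable_EFinP.
  rewrite (le_lt_trans _ (ltry M))//; apply: le_trans fM.
  by apply: ge0_le_integral => //=; try (by move=> x _; rewrite lee_fin);
    [exact/measurable_EFinP/measurableT_comp|exact/measurable_EFinP|
     move=> x _; rewrite lee_fin ger0_norm].
by split => //; rewrite -lee_fin -Rintegral_EFin.
Qed.

Lemma Rintegral_le f g : Rintegrable f -> Rintegrable g ->
  (forall x, f x <= g x) -> \int[mu]_x f x <= \int[mu]_x g x.
Proof. by move=> jf jg fg; apply: le_Rintegral => //. Qed.

Lemma Rintegral_add f g : Rintegrable f -> Rintegrable g ->
  \int[mu]_x (f x + g x) = \int[mu]_x f x + \int[mu]_x g x.
Proof. by move=> jf jg; exact: RintegralD. Qed.

Lemma Rintegral_sub f g : Rintegrable f -> Rintegrable g ->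
  \int[mu]_x (f x - g x) = \int[mu]_x f x - \int[mu]_x g x.
Proof. by move=> jf jg; exact: RintegralB. Qed.

Lemma Rintegral_scale k f : Rintegrable f ->
  \int[mu]_x (k * f x) = k * \int[mu]_x f x.
Proof. by move=> jf; exact: RintegralZl. Qed.

Lemma eqT_Rintegral f g : f =1 g -> \int[mu]_x f x = \int[mu]_x g x.
Proof. by move=> /funext ->. Qed.

Lemma Rintegral_opp f : Rintegrable f -> \int[mu]_x (- f x) = - \int[mu]_x f x.
Proof.
move=> jf; rewrite -mulN1r -Rintegral_scale//.
by apply: eqT_Rintegral => x; rewrite mulN1r.
Qed.

Lemma Rintegral_norm f : Rintegrable f ->
  `|\int[mu]_x f x| <= \int[mu]_x `|f x|.
Proof. by move=> jf; exact: le_normr_Rintegral. Qed.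

Lemma ae_eq_Rintegral f g : measurable_fun setT f -> measurable_fun setT g ->
  {ae mu, forall x, f x = g x} -> \int[mu]_x f x = \int[mu]_x g x.
Proof.
move=> mf mg fg; congr fine; apply: ae_eq_integral => //.
- exact/measurable_EFinP.
- exact/measurable_EFinP.
- by apply: filterS fg => x -> _.
Qed.

Lemma ae_eq_Rintegrable f g : measurable_fun setT f -> Rintegrable g ->
  {ae mu, forall x, f x = g x} -> Rintegrable f.
Proof.
move=> mf /integrableP[/measurable_EFinP mg jg] fg.
apply/integrableP; split; first exact/measurable_EFinP.
rewrite (ae_eq_integral (fun x => `|(g x)%:E|)%E)//.
- by apply: measurableT_comp => //; exact/measurable_EFinP.
- by apply: measurableT_comp => //; exact/measurable_EFinP.
- by apply: filterS fg => x /= -> _.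
Qed.

Lemma dominated_Rintegral (f_ : nat -> T -> R) f g :
  (forall n, measurable_fun setT (f_ n)) ->
  (forall x, f_ n x @[n --> \oo] --> f x) ->
  (forall n x, `|f_ n x| <= g x) -> Rintegrable g ->
  Rintegrable f /\ \int[mu]_x f_ n x @[n --> \oo] --> \int[mu]_x f x.
Proof.
move=> mf_ f_f fg jg.
have mf : measurable_fun setT f by apply: (measurable_fun_cvg mf_) => x _.
have [|||||jf _ cf] := @dominated_convergence _ T R mu setT measurableT
    (fun n => EFin \o f_ n) (EFin \o f) (EFin \o g).
- by move=> n; exact/measurable_EFinP.
- exact/measurable_EFinP.
- by apply: aeW => x _ /=; exact: (cvg_comp _ _ (f_f x)).
- exact: jg.
- by apply: aeW => x n _; rewrite lee_fin.
split => //.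
have jf_ n : Rintegrable (f_ n) by apply: Rintegrable_le (fg n) jg.
by apply/fine_cvg; rewrite -Rintegral_EFin.
Qed.

End real_integrals.

(** * Fubini's theorem for real integrals *)

Section fubini_real.
Context d1 d2 (T1 : measurableType d1) (T2 : measurableType d2) (R : realType).
Variables (m1 : {sigma_finite_measure set T1 -> \bar R})
          (m2 : {sigma_finite_measure set T2 -> \bar R}).
Implicit Types F : T1 * T2 -> R.

(** Tonelli's theorem applies to the positive and negative parts, and [fine] is measurable, so
    divergent sections cause no trouble. *)
Lemma measurable_Rintegral2 F : measurable_fun setT F ->
  measurable_fun setT (fun x => \int[m2]_y F (x, y)).
Proof.
move=> /measurable_EFinP mF; apply: measurableT_comp => //.
rewrite (_ : (fun _ => _) = fubini_F m2 (EFin \o F)^\+%E \-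
    fubini_F m2 (EFin \o F)^\-%E)%E.
  apply: emeasurable_funB.
  - by apply: measurable_fun_fubini_tonelli_F => //; exact: measurable_funepos.
  - by apply: measurable_fun_fubini_tonelli_F => //; exact: measurable_funeneg.
apply/funext => x; rewrite integralE; congr (_ - _)%E; apply: eq_integral => t _.
- by rewrite !funeposE.
- by rewrite !funenegE.
Qed.

Lemma measurable_Rintegral1 F : measurable_fun setT F ->
  measurable_fun setT (fun y => \int[m1]_x F (x, y)).
Proof.
move=> /measurable_EFinP mF; apply: measurableT_comp => //.
rewrite (_ : (fun _ => _) = fubini_G m1 (EFin \o F)^\+%E \-
    fubini_G m1 (EFin \o F)^\-%E)%E.
  apply: emeasurable_funB.
  - by apply: measurable_fun_fubini_tonelli_G => //; exact: measurable_funepos.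
  - by apply: measurable_fun_fubini_tonelli_G => //; exact: measurable_funeneg.
apply/funext => y; rewrite integralE; congr (_ - _)%E; apply: eq_integral => t _.
- by rewrite !funeposE.
- by rewrite !funenegE.
Qed.

(** The real inner integral agrees with the extended one wherever the section is integrable, that
    is, off a null set. *)
Lemma Rfubini1 F : Rintegrable (m1 \x m2)%E F ->
  \int[m1]_x \int[m2]_y F (x, y) = \int[(m1 \x m2)%E]_z F z.
Proof.
move=> jF; have mF := Rintegrable_measurable jF.
rewrite [RHS]/Rintegral -(integral12_prod_meas1 jF).
congr fine; apply: ae_eq_integral => //.
- exact/measurable_EFinP/measurable_Rintegral2.
- exact: (measurable_fubini_F jF).
apply: filterS (ae_integrable1 jF) => x jFx _.
by rewrite -Rintegral_EFin.
Qed.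

Lemma Rfubini2 F : Rintegrable (m1 \x m2)%E F ->
  \int[m2]_y \int[m1]_x F (x, y) = \int[(m1 \x m2)%E]_z F z.
Proof.
move=> jF; have mF := Rintegrable_measurable jF.
rewrite [RHS]/Rintegral -(integral21_prod_meas1 jF).
congr fine; apply: ae_eq_integral => //.
- exact/measurable_EFinP/measurable_Rintegral1.
- exact: (measurable_fubini_G jF).
apply: filterS (ae_integrable2 jF) => x jFx _.
by rewrite -Rintegral_EFin.
Qed.

Lemma Rfubini F : Rintegrable (m1 \x m2)%E F ->
  \int[m1]_x \int[m2]_y F (x, y) = \int[m2]_y \int[m1]_x F (x, y).
Proof. by move=> jF; rewrite Rfubini1// Rfubini2. Qed.

Lemma Rintegrable_fubini1 F : Rintegrable (m1 \x m2)%E F ->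
  Rintegrable m1 (fun x => \int[m2]_y F (x, y)).
Proof.
move=> jF; have mF := Rintegrable_measurable jF.
have [N [mN N0 subN]] := ae_integrable1 jF.
apply/(negligible_integrable mN measurableT _ N0).
  exact/measurable_EFinP/measurable_Rintegral2.
have := @integrable_fubini_F _ _ _ _ _ m1 m2 _ jF.
move/(negligible_integrable mN measurableT _ N0) => /(_ (measurable_fubini_F jF)).
apply: eq_integrable; first by exact: measurableD.
move=> x; rewrite inE => -[_ /= Nx]; rewrite -Rintegral_EFin//.
by apply: contrapT => h; apply: Nx; apply: subN.
Qed.

Lemma Rintegrable_prod1 F (G : T1 -> R) : measurable_fun setT F ->
  (forall x, Rintegrable m2 (fun y => F (x, y))) ->
  (forall x, \int[m2]_y `|F (x, y)| <= G x) -> Rintegrable m1 G ->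
  Rintegrable (m1 \x m2)%E F.
Proof.
move=> mF jF FG jG; apply/integrable12ltyP; first exact/measurable_EFinP.
move/integrableP : (jG) => [/measurable_EFinP mG]; apply: le_lt_trans.
apply: ge0_le_integral => //=.
- by move=> x _; exact: integral_ge0.
- have : measurable_fun setT (fubini_F m2 (fun z => `|(F z)%:E|%E)); last by [].
  apply: measurable_fun_fubini_tonelli_F => //.
  by apply: measurableT_comp => //; exact/measurable_EFinP.
- exact/measurable_EFinP/measurableT_comp.
move=> x _; rewrite Rintegral_EFin ?lee_fin; last exact: Rintegrable_norm.
by rewrite (le_trans (FG x))// ler_norm.
Qed.

Lemma Rintegrable_prod2 F (G : T2 -> R) : measurable_fun setT F ->
  (forall y, Rintegrable m1 (fun x => F (x, y))) ->
  (forall y, \int[m1]_x `|F (x, y)| <= G y) -> Rintegrable m2 G ->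
  Rintegrable (m1 \x m2)%E F.
Proof.
move=> mF jF FG jG; apply/integrable21ltyP; first exact/measurable_EFinP.
move/integrableP : (jG) => [/measurable_EFinP mG]; apply: le_lt_trans.
apply: ge0_le_integral => //=.
- by move=> x _; exact: integral_ge0.
- have : measurable_fun setT (fubini_G m1 (fun z => `|(F z)%:E|%E)); last by [].
  apply: measurable_fun_fubini_tonelli_G => //.
  by apply: measurableT_comp => //; exact/measurable_EFinP.
- exact/measurable_EFinP/measurableT_comp.
move=> x _; rewrite Rintegral_EFin ?lee_fin; last exact: Rintegrable_norm.
by rewrite (le_trans (FG x))// ler_norm.
Qed.

Lemma measurable_fst_comp (f : T1 -> R) : measurable_fun setT f ->
  measurable_fun setT (fun z : T1 * T2 => f z.1).
Proof. by move=> mf; exact: measurableT_comp mf measurable_fst. Qed.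

Lemma measurable_snd_comp (f : T2 -> R) : measurable_fun setT f ->
  measurable_fun setT (fun z : T1 * T2 => f z.2).
Proof. by move=> mf; exact: measurableT_comp mf measurable_snd. Qed.

Lemma Rintegrable_tensor (f : T1 -> R) (g : T2 -> R) :
  Rintegrable m1 f -> Rintegrable m2 g ->
  Rintegrable (m1 \x m2)%E (fun z => f z.1 * g z.2).
Proof.
move=> jf jg.
apply: (@Rintegrable_prod1 _ (fun x => \int[m2]_y `|g y| * `|f x|)) => /=.
- apply: measurable_funM.
  + exact: (measurable_fst_comp (Rintegrable_measurable jf)).
  + exact: (measurable_snd_comp (Rintegrable_measurable jg)).
- by move=> x; exact: RintegrableZl.
- move=> x; under eq_fun do rewrite normrM.
  by rewrite Rintegral_scale ?(mulrC `|f x|)//; exact: Rintegrable_norm.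
- by apply: RintegrableZl; exact: Rintegrable_norm.
Qed.

End fubini_real.

(** * Reflections and translations of Lebesgue measure *)

Section translation.
Context (R : realType).
Local Notation mu := (@lebesgue_measure R).

Let reflect (x : R) : measurableTypeR R -> measurableTypeR R := fun y => x - y.

Let measurable_reflect x : measurable_fun setT (reflect x).
Proof. by rewrite /reflect; apply: measurable_funB => //; exact: measurable_cst. Qed.

(** The preimage of []a, b]] is [[x - b, x - a[], of the same length, and the values on such
    intervals determine Lebesgue measure. Translations are obtained below as composites of two
    reflections. *)
Let pushforward_reflect x (A : set R) : measurable A ->
  pushforward mu (reflect x) A = mu A.
Proof.
have [m mE] : exists m : {measure set (measurableTypeR R) -> \bar R},
    (m : set R -> \bar R) = pushforward mu (reflect x).
  have h : measurable_fun setT (reflect x) by exact: measurable_reflect.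
  by exists (measure_function_pushforward__canonical__measure_function_Measure mu h).
move=> mA; apply/esym; rewrite -mE.
apply: lebesgue_measure_unique => //= _ [[a b]] _ <-.
rewrite mE /pushforward (_ : reflect x @^-1` _ = `[x - b, x - a[%classic).
  rewrite !lebesgue_measure_itv/= !lte_fin ltrD2l ltrN2.
  by case: ifP => // _; rewrite -!EFinD; congr EFin; ring.
apply/seteqP; split => y /=; rewrite /reflect !in_itv/= => /andP[? ?];
  apply/andP; split; lra.
Qed.

Lemma Rintegrable_reflect (f : R -> R) x : Rintegrable mu f ->
  Rintegrable mu (fun y => f (x - y)).
Proof.
move=> jf; have mf := Rintegrable_measurable jf.
have mfx : measurable_fun setT (fun y : R => f (x - y)).
  exact: (measurableT_comp mf (measurable_reflect x)).
apply/integrableP; split; first exact/measurable_EFinP.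
move/integrableP : jf => [_]; apply: le_lt_trans.
rewrite le_eqVlt; apply/orP; left; apply/eqP.
have mabs : measurable_fun setT (fun y : R => `|(f y)%:E|%E).
  by apply: measurableT_comp => //; exact/measurable_EFinP.
have := ge0_integral_pushforward (measurable_reflect x) lebesgue_measure measurableT mabs.
rewrite preimage_setT => <-; last by move=> *; exact: abse_ge0.
by apply: eq_measure_integral => A mA _; exact: pushforward_reflect.
Qed.

Lemma Rintegral_reflect (f : R -> R) x : Rintegrable mu f ->
  \int[mu]_y f (x - y) = \int[mu]_y f y.
Proof.
move=> jf; congr fine.
have mf := Rintegrable_measurable jf.
have := @integral_pushforward _ _ _ _ R _ (measurable_reflect x) lebesgue_measure setT (EFin \o f).
rewrite preimage_setT => <-//.
- by apply: eq_measure_integral => A mA _; exact: pushforward_reflect.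
- exact/measurable_EFinP.
- exact: Rintegrable_reflect.
Qed.

Lemma Rintegrable_opp (f : R -> R) : Rintegrable mu f ->
  Rintegrable mu (fun y => f (- y)).
Proof.
by move/(@Rintegrable_reflect _ 0); apply: eq_Rintegrable => y; rewrite sub0r.
Qed.

Lemma Rintegral_reflect0 (f : R -> R) : Rintegrable mu f ->
  \int[mu]_y f (- y) = \int[mu]_y f y.
Proof.
move/(@Rintegral_reflect _ 0) => <-.
by apply: eqT_Rintegral => y; rewrite sub0r.
Qed.

Lemma Rintegrable_shift (f : R -> R) x : Rintegrable mu f ->
  Rintegrable mu (fun y => f (y - x)).
Proof.
by move/Rintegrable_opp/(@Rintegrable_reflect _ x); apply: eq_Rintegrable => y; rewrite opprB.
Qed.

Lemma Rintegral_shift (f : R -> R) x : Rintegrable mu f ->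
  \int[mu]_y f (y - x) = \int[mu]_y f y.
Proof.
move=> jf; rewrite -(Rintegral_reflect0 jf) -(Rintegral_reflect x (Rintegrable_opp jf)).
by apply: eqT_Rintegral => y; rewrite opprB.
Qed.

End translation.

Section fatou_real.
Context d (T : measurableType d) (R : realType).
Variable mu : {measure set T -> \bar R}.

Lemma fatou_Rintegral (f_ : nat -> T -> R) (f : T -> R) (M : R) :
  (forall n, Rintegrable mu (f_ n)) -> (forall n x, 0 <= f_ n x) ->
  measurable_fun setT f -> (forall x, 0 <= f x) ->
  {ae mu, forall x, f_ n x @[n --> \oo] --> f x} ->
  (forall n, \int[mu]_x f_ n x <= M) ->
  Rintegrable mu f /\ \int[mu]_x f x <= M.
Proof.
move=> jf_ f_0 mf f0 cf fM; apply: ge0_Rintegrable => //.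
have mf_ n : measurable_fun setT (EFin \o f_ n).
  exact/measurable_EFinP/(Rintegrable_measurable (jf_ n)).
apply: (@le_trans _ _ (\int[mu]_x limn_einf (fun n => (f_ n x)%:E))%E).
  rewrite le_eqVlt; apply/orP; left; apply/eqP; apply: ae_eq_integral => //.
  - exact/measurable_EFinP.
  - rewrite /limn_einf; apply: measurableT_comp => //.
    apply: (measurable_fun_limn_esup (f := fun n x => (- (f_ n x)%:E)%E)) => n.
    by apply: (measurableT_comp (f := -%E) _ (mf_ n)).
  apply: filterS cf => x cx _ /=.
  have /cvg_limn_einf_sup[-> //] : (EFin \o f_^~ x) n @[n --> \oo] --> (f x)%:E.
  exact: cvg_comp cx _.
apply: (le_trans (fatou mu measurableT mf_ _)).
  by move=> n x _; rewrite lee_fin.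
rewrite limn_einf_lim; apply: lime_le; first exact: is_cvg_einfs.
apply: nearW => n; apply: (@le_trans _ _ (\int[mu]_x (f_ n x)%:E)%E).
  by apply: ereal_inf_lbound; exists n => //=.
by rewrite Rintegral_EFin// lee_fin.
Qed.

End fatou_real.

Section finite_sums.
Context d (T : measurableType d) (R : realType).
Variable mu : {measure set T -> \bar R}.

Lemma Rintegrable_bigsum n (f : nat -> T -> R) : (forall i, Rintegrable mu (f i)) ->
  Rintegrable mu (fun x => \sum_(i < n) f i x) /\
  \int[mu]_x (\sum_(i < n) f i x) = \sum_(i < n) \int[mu]_x f i x.
Proof.
move=> jf; elim: n => [|n [IH1 IH2]].
  under eq_fun do rewrite big_ord0; rewrite big_ord0; split; first exact: integrable0.
  by rewrite /Rintegral integral0.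
under eq_fun do rewrite big_ord_recr/=; rewrite big_ord_recr/=; split.
  exact: RintegrableD.
by rewrite -IH2 Rintegral_add.
Qed.

End finite_sums.

(** * The Poisson kernel and its conjugate *)

Section whole_line_FTC.
Context (R : realType).
Local Notation mu := (@lebesgue_measure R).

(** The successor keeps the segment nondegenerate at [n = 0], as the fundamental theorem of calculus
    on a segment requires. *)
Let seg (n : nat) : set R := `[- n.+1%:R, n.+1%:R]%classic.

Let mseg n : measurable (seg n : set (measurableTypeR R)).
Proof. exact: measurable_itv. Qed.

Let cvg_seg (f : R -> R) x : (f \_ (seg n)) x @[n --> \oo] --> f x.
Proof.
apply: cvg_near_cst; near=> n; rewrite patchE mem_set//= /seg/= in_itv/=.
rewrite -ler_norml (@le_trans _ _ n%:R) ?ler_nat//.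
by near: n; exact: nbhs_infty_ger.
Unshelve. all: end_near. Qed.

Let segE (f F : R -> R) n : continuous f ->
  (forall x : R, is_derive x (1 : R) F (f x)) ->
  Rintegrable mu (f \_ (seg n)) /\
  \int[mu]_x (f \_ (seg n)) x = F n.+1%:R - F (- n.+1%:R).
Proof.
move=> cf dF; split.
  rewrite /Rintegrable -restrict_EFin; apply/integrable_restrict => //.
  rewrite setTI; apply: continuous_compact_integrable; first exact: segment_compact.
  exact: continuous_subspaceT.
rewrite -Rintegral_mkcond /Rintegral /seg.
have dF' x : derivable F x (1 : R) by exact: (@ex_derive _ _ _ _ _ _ _ (dF x)).
have cF : continuous F.
  by move=> x; apply: differentiable_continuous; exact/derivable1_diffP.
rewrite (@continuous_FTC2 _ f F)//.
- by rewrite (@lt_trans _ _ 0)// oppr_lt0.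
- exact: continuous_subspaceT.
- split => [x _||]; first exact: dF'.
  + by apply: cvg_at_right_filter; exact: cF.
  + by apply: cvg_at_left_filter; exact: cF.
- by move=> x _; rewrite derive1E; exact: derive_val.
Qed.

(** The integrals over the segments are increments of [F], hence at most [M], and Fatou's lemma
    passes this bound to the whole line. *)
Lemma ge0_Rintegrable_FTC (f F : R -> R) M : continuous f ->
  (forall x, 0 <= f x) -> (forall x : R, is_derive x (1 : R) F (f x)) ->
  (forall n, F n.+1%:R - F (- n.+1%:R) <= M) ->
  Rintegrable mu f.
Proof.
move=> cf f0 dF FM.
have mf : measurable_fun (setT : set R) f by exact: continuous_measurable_fun.
have [] := @fatou_Rintegral _ _ R mu (fun n => f \_ (seg n)) f M _ _ mf f0.
- by move=> n; have [] := segE n cf dF.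
- by move=> n x; rewrite patchE; case: ifPn.
- exact: aeW.
- by move=> n; have [_ ->] := segE n cf dF.
by [].
Qed.

Lemma Rintegral_FTC (f F : R -> R) l : continuous f ->
  (forall x : R, is_derive x (1 : R) F (f x)) -> Rintegrable mu f ->
  F n.+1%:R - F (- n.+1%:R) @[n --> \oo] --> l ->
  \int[mu]_x f x = l.
Proof.
move=> cf dF jf Fl.
have mf := Rintegrable_measurable jf.
have [||||_] := @dominated_Rintegral _ _ R mu (fun n => f \_ (seg n)) f (fun x => `|f x|).
- by move=> n; have [+ _] := segE n cf dF => /Rintegrable_measurable.
- by move=> x; exact: cvg_seg.
- by move=> n x; rewrite patchE; case: ifPn => // _; rewrite normr0.
- exact: Rintegrable_norm.
under eq_fun do rewrite (segE _ cf dF).2.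
by move=> /(cvg_unique _ Fl) ->.
Qed.

End whole_line_FTC.

Section derive_rules.
Context (R : realType).
Implicit Types (f g : R -> R) (x y c k : R).

Lemma is_derive1_lcomp f g x a b : is_derive (g x) (1 : R) f a ->
  is_derive x (1 : R) g b -> is_derive x (1 : R) (fun y => f (g y)) (a * b).
Proof. by move=> df dg; exact: is_derive1_comp. Qed.

Lemma is_derive1_lscale k f x a : is_derive x (1 : R) f a ->
  is_derive x (1 : R) (fun y => k * f y) (k * a).
Proof. by move=> df; exact: is_deriveZ. Qed.

Lemma is_derive1_ladd f g x a b : is_derive x (1 : R) f a ->
  is_derive x (1 : R) g b -> is_derive x (1 : R) (fun y => f y + g y) (a + b).
Proof. by move=> df dg; exact: is_deriveD. Qed.

Let is_derive_shift c x : is_derive x (1 : R) (fun y => y - c) (1 : R).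
Proof.
rewrite -[X in is_derive _ _ _ X]addr0.
by apply: is_derive1_ladd.
Qed.

Let is_derive_quad c k x : is_derive x (1 : R) (fun y => (y - c) ^+ 2 + k) (2 * (x - c)).
Proof.
rewrite -[X in is_derive _ _ _ X]addr0.
apply: is_derive1_ladd.
rewrite (_ : (fun y => _) = (fun y => y - c) * (fun y => y - c)); last first.
  by apply/funext => y; rewrite expr2.
have s := is_derive_shift c x.
by apply: is_derive_eq; rewrite /GRing.scale /=; ring.
Qed.

Lemma is_derive_atan_scale a c x : 0 < a ->
  is_derive x (1 : R) (fun y => atan ((y - c) / a)) (a / ((x - c) ^+ 2 + a ^+ 2)).
Proof.
move=> a0.
have -> : a / ((x - c) ^+ 2 + a ^+ 2) = (1 + (a^-1 * (x - c)) ^+ 2)^-1 * (a^-1 * 1).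
  have d0 : (x - c) ^+ 2 + a ^+ 2 != 0.
    by rewrite lt0r_neq0// ltr_wpDl ?sqr_ge0// exprn_gt0.
  by field; rewrite (addrC (a ^+ 2)) d0 gt_eqF.
rewrite (_ : (fun y => _) = (fun y => atan (a^-1 * (y - c)))); last first.
  by apply/funext => y; rewrite mulrC.
apply: (@is_derive1_lcomp atan (fun y => a^-1 * (y - c))).
by apply: is_derive1_lscale; exact: is_derive_shift.
Qed.

Lemma is_derive_ln_quad a c x : 0 < a ->
  is_derive x (1 : R) (fun y => 2^-1 * ln ((y - c) ^+ 2 + a ^+ 2))
    ((x - c) / ((x - c) ^+ 2 + a ^+ 2)).
Proof.
move=> a0.
have d0 : 0 < (x - c) ^+ 2 + a ^+ 2 by rewrite ltr_wpDl ?sqr_ge0// exprn_gt0.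
have -> : (x - c) / ((x - c) ^+ 2 + a ^+ 2) =
    2^-1 * (((x - c) ^+ 2 + a ^+ 2)^-1 * (2 * (x - c))).
  by field; rewrite gt_eqF.
apply: is_derive1_lscale.
apply: (@is_derive1_lcomp (@ln R) (fun y => (y - c) ^+ 2 + a ^+ 2)).
  exact: is_derive1_ln.
exact: is_derive_quad.
Qed.

End derive_rules.

Section poisson_kernels.
Context (R : realType).
Local Notation mu := (@lebesgue_measure R).
Implicit Types a b s t x y z : R.

(** Without the usual factor [pi^-1]: the total mass is [pi], and the conjugate kernel
    [cpoisson a z] tends to [z^-1] as [a] tends to 0. *)
Definition poisson a z : R := a / (z ^+ 2 + a ^+ 2).

Definition cpoisson a z : R := z / (z ^+ 2 + a ^+ 2).

Lemma poisson_den_gt0 a z : 0 < a -> 0 < z ^+ 2 + a ^+ 2.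
Proof. by move=> a0; rewrite ltr_wpDl ?sqr_ge0// exprn_gt0. Qed.

Lemma poissonN a z : poisson a (- z) = poisson a z.
Proof. by rewrite /poisson sqrrN. Qed.

Lemma cpoissonN a z : cpoisson a (- z) = - cpoisson a z.
Proof. by rewrite /cpoisson sqrrN mulNr. Qed.

Lemma poisson_gt0 a z : 0 < a -> 0 < poisson a z.
Proof. by move=> a0; rewrite divr_gt0// poisson_den_gt0. Qed.

Lemma poisson_ge0 a z : 0 < a -> 0 <= poisson a z.
Proof. by move=> a0; rewrite ltW// poisson_gt0. Qed.

(** This bound and the next reflect the identity [poisson a z ^+ 2 + cpoisson a z ^+ 2 = a^-1 *
    poisson a z]. They put both kernels in L^2, although [cpoisson a] is not integrable. *)
Lemma poisson_sqr_le a z : 0 < a -> poisson a z ^+ 2 <= a^-1 * poisson a z.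
Proof.
move=> a0; have d0 := poisson_den_gt0 z a0.
rewrite expr2 ler_pM2r ?poisson_gt0// /poisson ler_pdivrMr// mulrDr.
by rewrite expr2 mulKf ?gt_eqF// lerDr mulr_ge0 ?sqr_ge0 ?invr_ge0 ?ltW.
Qed.

Lemma cpoisson_sqr_le a z : 0 < a -> cpoisson a z ^+ 2 <= a^-1 * poisson a z.
Proof.
move=> a0; have d0 := poisson_den_gt0 z a0.
rewrite /cpoisson /poisson mulKf ?gt_eqF// exprMn exprVn ler_pdivrMr ?exprn_gt0//.
by rewrite [X in _ <= _ * X]expr2 mulKf ?lt0r_neq0// lerDl sqr_ge0.
Qed.

Lemma continuous_poisson a : 0 < a -> continuous (poisson a).
Proof.
move=> a0 z; rewrite /poisson; apply: cvgM; first exact: cvg_cst.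
apply: cvgV; first by rewrite gt_eqF// poisson_den_gt0.
by apply: cvgD; [exact: exprn_continuous|exact: cvg_cst].
Qed.

Lemma continuous_cpoisson a : 0 < a -> continuous (cpoisson a).
Proof.
move=> a0 z; rewrite /cpoisson; apply: cvgM; first exact: cvg_id.
apply: cvgV; first by rewrite gt_eqF// poisson_den_gt0.
by apply: cvgD; [exact: exprn_continuous|exact: cvg_cst].
Qed.

Lemma measurable_poisson a : 0 < a -> measurable_fun (setT : set R) (poisson a).
Proof. by move=> a0; apply: continuous_measurable_fun; exact: continuous_poisson. Qed.

Lemma measurable_cpoisson a : 0 < a -> measurable_fun (setT : set R) (cpoisson a).
Proof. by move=> a0; apply: continuous_measurable_fun; exact: continuous_cpoisson. Qed.

Let cvg_atan_scale a c : 0 < a -> atan ((n.+1%:R + c) / a) @[n --> \oo] --> pi / 2.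
Proof.
move=> a0; apply: cvg_comp (@cvgy_atan R); apply/cvgryPge => M.
near=> n; rewrite ler_pdivlMr// -lerBlDr.
rewrite (@le_trans _ _ n%:R) ?ler_nat//.
by near: n; exact: nbhs_infty_ger.
Unshelve. all: end_near. Qed.

Lemma Rintegrable_poisson a : 0 < a -> Rintegrable mu (poisson a).
Proof.
move=> a0; apply: (@ge0_Rintegrable_FTC _ _ (fun y => atan ((y - 0) / a)) pi).
- exact: continuous_poisson.
- by move=> z; exact: poisson_ge0.
- by move=> x; have := is_derive_atan_scale 0 x a0; rewrite [in X in is_derive _ _ _ X]subr0.
move=> n; rewrite !subr0 mulNr atanN opprK.
have := @atan_ltpi2 R (n.+1%:R / a); lra.
Qed.

Lemma Rintegral_poisson a : 0 < a -> \int[mu]_z poisson a z = pi.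
Proof.
move=> a0; apply: (@Rintegral_FTC _ _ (fun y => atan ((y - 0) / a)) pi).
- exact: continuous_poisson.
- by move=> x; have := is_derive_atan_scale 0 x a0; rewrite [in X in is_derive _ _ _ X]subr0.
- exact: Rintegrable_poisson.
rewrite (_ : pi = pi / 2 + pi / 2 :> R); last by lra.
under eq_fun do rewrite !subr0 mulNr atanN opprK.
have := cvg_atan_scale 0 a0; under eq_fun do rewrite addr0.
by move=> h; exact: cvgD.
Qed.

Lemma Rintegrable_poisson_sqr a : 0 < a -> Rintegrable mu (fun z => poisson a z ^+ 2).
Proof.
move=> a0; apply: Rintegrable_le (RintegrableZl a^-1 (Rintegrable_poisson a0)).
  exact: measurable_funX (measurable_poisson a0).
by move=> z; rewrite ger0_norm ?sqr_ge0// poisson_sqr_le.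
Qed.

Lemma Rintegrable_cpoisson_sqr a : 0 < a -> Rintegrable mu (fun z => cpoisson a z ^+ 2).
Proof.
move=> a0; apply: Rintegrable_le (RintegrableZl a^-1 (Rintegrable_poisson a0)).
  exact: measurable_funX (measurable_cpoisson a0).
by move=> z; rewrite ger0_norm ?sqr_ge0// cpoisson_sqr_le.
Qed.

(** Each logarithm diverges. Dividing by [n.+1%:R ^+ 2] turns their difference into a function of
    [n.+1%:R^-1] that is continuous at 0, where its value is [ln 1]. *)
Let quot_ln a b x (n : nat) : 0 < a -> 0 < b ->
  ln (n.+1%:R ^+ 2 + b ^+ 2) - ln ((n.+1%:R - x) ^+ 2 + a ^+ 2) =
  ln ((1 + b ^+ 2 * n.+1%:R^-1 ^+ 2) /
    ((1 - x * n.+1%:R^-1) ^+ 2 + a ^+ 2 * n.+1%:R^-1 ^+ 2)) :> R.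
Proof.
move=> a0 b0.
have h1 : 0 < n.+1%:R ^+ 2 + b ^+ 2 :> R by rewrite ltr_wpDl ?sqr_ge0// exprn_gt0.
have h2 : 0 < (n.+1%:R - x) ^+ 2 + a ^+ 2 by rewrite ltr_wpDl ?sqr_ge0// exprn_gt0.
have : 0 < n.+1%:R :> R by [].
rewrite -ln_div ?posrE// => n0; congr ln; move: n0; move: n.+1%:R h1 h2 => m h1 h2 m0.
have -> : (1 - x * m^-1) ^+ 2 + a ^+ 2 * m^-1 ^+ 2 = ((m - x) ^+ 2 + a ^+ 2) / m ^+ 2.
  by field; rewrite gt_eqF.
by field; rewrite !gt_eqF.
Qed.

Let cvg_quot_ln a b x : 0 < a -> 0 < b ->
  ln (n.+1%:R ^+ 2 + b ^+ 2) - ln ((n.+1%:R - x) ^+ 2 + a ^+ 2)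
  @[n --> \oo] --> (0 : R).
Proof.
move=> a0 b0; under eq_fun do rewrite quot_ln//.
pose r (u : R) := ln ((1 + b ^+ 2 * u ^+ 2) / ((1 - x * u) ^+ 2 + a ^+ 2 * u ^+ 2)).
have r0 : r 0 = 0.
  by rewrite /r expr0n/= !mulr0 subr0 !addr0 expr1n divr1 ln1.
have cr : {for 0, continuous r}.
  apply: continuous_comp; last first.
    by apply: continuous_ln; rewrite expr0n/= !mulr0 subr0 !addr0 expr1n divr1.
  apply: cvgM.
    apply: cvgD; first exact: cvg_cst.
    by apply: cvgM; [exact: cvg_cst|exact: exprn_continuous].
  apply: cvgV; first by rewrite expr0n/= !mulr0 subr0 !addr0 expr1n oner_neq0.
  apply: cvgD; last by apply: cvgM; [exact: cvg_cst|exact: exprn_continuous].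
  rewrite expr2; under eq_fun do rewrite expr2.
  by apply: cvgM; apply: cvgB; (try exact: cvg_cst); apply: cvgM;
    (try exact: cvg_cst); exact: cvg_id.
by rewrite -r0; exact: (cvg_comp _ _ (@cvg_harmonic R) cr).
Qed.

(** The common coefficient [A] makes the logarithms enter the primitive as [ln] of a quotient
    tending to 1 at both ends; each arctangent contributes [pi]. Integrability is asked of the sum
    because the [cpoisson] terms are not integrable one by one. *)
Lemma Rintegral_partial_fractions a b x A B C (f : R -> R) : 0 < a -> 0 < b ->
  (forall y, f y = A * (cpoisson b y + cpoisson a (x - y)) +
                   B * poisson b y + C * poisson a (x - y)) ->
  Rintegrable mu f -> \int[mu]_y f y = pi * (B + C).
Proof.
move=> a0 b0 fE jf.
pose F y := A * (2^-1 * ln ((y - 0) ^+ 2 + b ^+ 2) + (-1) *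
  (2^-1 * ln ((y - x) ^+ 2 + a ^+ 2))) + B * atan ((y - 0) / b) + C * atan ((y - x) / a).
apply: (@Rintegral_FTC _ f F) => //.
- have -> : f = (fun y => A * (cpoisson b y + cpoisson a (x - y)) +
                   B * poisson b y + C * poisson a (x - y)) by exact/funext.
  have cs : continuous (fun y : R => x - y).
    by move=> y; apply: cvgB; [exact: cvg_cst|exact: cvg_id].
  move=> y; apply: cvgD; first apply: cvgD.
  + apply: cvgM; first exact: cvg_cst.
    apply: cvgD; first exact: continuous_cpoisson.
    by apply: (@continuous_comp _ _ _ (fun y => x - y)); [exact: cs|exact: continuous_cpoisson].
  + by apply: cvgM; [exact: cvg_cst|exact: continuous_poisson].
  + apply: cvgM; first exact: cvg_cst.
    by apply: (@continuous_comp _ _ _ (fun y => x - y)); [exact: cs|exact: continuous_poisson].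
- move=> y.
  have -> : f y = A * ((y - 0) / ((y - 0) ^+ 2 + b ^+ 2) +
        (-1) * ((y - x) / ((y - x) ^+ 2 + a ^+ 2))) +
      B * (b / ((y - 0) ^+ 2 + b ^+ 2)) + C * (a / ((y - x) ^+ 2 + a ^+ 2)).
    by rewrite fE -opprB cpoissonN poissonN subr0 mulN1r.
  apply: is_derive1_ladd; [apply: is_derive1_ladd|];
    apply: is_derive1_lscale; [apply: is_derive1_ladd| |].
  + exact: is_derive_ln_quad.
  + by apply: is_derive1_lscale; exact: is_derive_ln_quad.
  + exact: is_derive_atan_scale.
  + exact: is_derive_atan_scale.
rewrite (_ : pi * (B + C) = A * 2^-1 * (0 - 0) + B * (pi / 2 + pi / 2) +
  C * (pi / 2 + pi / 2)); last by field.
have FE n : F n.+1%:R - F (- n.+1%:R) =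
  A * 2^-1 * ((ln (n.+1%:R ^+ 2 + b ^+ 2) - ln ((n.+1%:R - x) ^+ 2 + a ^+ 2)) -
    (ln (n.+1%:R ^+ 2 + b ^+ 2) - ln ((n.+1%:R - - x) ^+ 2 + a ^+ 2))) +
  B * (atan ((n.+1%:R + 0) / b) + atan ((n.+1%:R + 0) / b)) +
  C * (atan ((n.+1%:R - x) / a) + atan ((n.+1%:R + x) / a)).
  rewrite /F !subr0 !addr0 sqrrN -opprD sqrrN !mulNr !atanN opprK; ring.
under eq_fun do rewrite FE.
apply: cvgD; first apply: cvgD.
- apply: cvgM; first exact: cvg_cst.
  by apply: cvgB; exact: cvg_quot_ln.
- by apply: cvgM; [exact: cvg_cst|apply: cvgD; exact: cvg_atan_scale].
- by apply: cvgM; [exact: cvg_cst|apply: cvgD; exact: cvg_atan_scale].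
Qed.

Let Rintegrable_mul_sqr (u v : R -> R) : measurable_fun (setT : set R) u ->
  measurable_fun (setT : set R) v -> Rintegrable mu (fun z => u z ^+ 2) ->
  Rintegrable mu (fun z => v z ^+ 2) -> Rintegrable mu (fun z => u z * v z).
Proof.
move=> mu_ mv ju jv; apply: Rintegrable_le (RintegrableD ju jv).
  exact: measurable_funM.
move=> z; have := sqr_ge0 (u z + v z); have := sqr_ge0 (u z - v z).
rewrite ler_norml; nra.
Qed.

Let measurable_reflected (u : R -> R) x : measurable_fun (setT : set R) u ->
  measurable_fun (setT : set R) (fun y => u (x - y)).
Proof.
move=> h; apply: measurableT_comp => //; apply: measurable_funB => //.
Qed.

(* Real part of [c_a(x - y) c_b(y) = c_(a+b)(x) (c_b(y) + c_a(x - y))], where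
   [c_a(z) = 1 / (z + i a) = cpoisson a z - i poisson a z]. *)
Lemma poisson_convolution a b x : 0 < a -> 0 < b ->
  \int[mu]_y (cpoisson a (x - y) * cpoisson b y - poisson a (x - y) * poisson b y) =
  - (2 * pi * poisson (a + b) x).
Proof.
move=> a0 b0.
rewrite (@Rintegral_partial_fractions a b x (cpoisson (a + b) x)
  (- poisson (a + b) x) (- poisson (a + b) x))//; first by ring.
- move=> y; have d1 := poisson_den_gt0 (x - y) a0; have d2 := poisson_den_gt0 y b0.
  have d3 := poisson_den_gt0 x (addr_gt0 a0 b0).
  by rewrite /poisson /cpoisson; field; rewrite !gt_eqF.
- apply: RintegrableB; apply: Rintegrable_mul_sqr.
  + by apply: measurable_reflected; exact: measurable_cpoisson.
  + exact: measurable_cpoisson.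
  + exact: (Rintegrable_reflect x (Rintegrable_cpoisson_sqr a0)).
  + exact: Rintegrable_cpoisson_sqr.
  + by apply: measurable_reflected; exact: measurable_poisson.
  + exact: measurable_poisson.
  + exact: (Rintegrable_reflect x (Rintegrable_poisson_sqr a0)).
  + exact: Rintegrable_poisson_sqr.
Qed.

(* Combines the imaginary part of that identity with the one for [c_a(x - y)] times the
   conjugate of [c_b(y)], whose partial fractions have the denominator [x + i (a - b)]. *)
Lemma poisson_cpoisson_convolution a b x : 0 < a -> 0 < b -> a != b ->
  \int[mu]_y (poisson a (x - y) * cpoisson b y) = pi * cpoisson (a + b) x.
Proof.
move=> a0 b0 ab.
rewrite (@Rintegral_partial_fractions a b x
  (2^-1 * (poisson (a + b) x + poisson (a - b) x))
  (2^-1 * (cpoisson (a + b) x - cpoisson (a - b) x))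
  (2^-1 * (cpoisson (a + b) x + cpoisson (a - b) x)))//; first by field.
- move=> y; have d1 := poisson_den_gt0 (x - y) a0; have d2 := poisson_den_gt0 y b0.
  have d3 := poisson_den_gt0 x (addr_gt0 a0 b0).
  have d4 : 0 < x ^+ 2 + (a - b) ^+ 2.
    by rewrite ltr_wpDl ?sqr_ge0// exprn_even_gt0//= subr_eq0.
  by rewrite /poisson /cpoisson; field; rewrite !gt_eqF.
- apply: Rintegrable_mul_sqr.
  + by apply: measurable_reflected; exact: measurable_poisson.
  + exact: measurable_cpoisson.
  + exact: (Rintegrable_reflect x (Rintegrable_poisson_sqr a0)).
  + exact: Rintegrable_cpoisson_sqr.
Qed.

End poisson_kernels.

(** * Completeness of the space of square-integrable functions *)

Section square_integrable.
Context d (T : measurableType d) (R : realType).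
Variable mu : {measure set T -> \bar R}.
Implicit Types u v : T -> R.

Definition Rintegrable2 u := measurable_fun setT u /\ Rintegrable mu (fun x => u x ^+ 2).

Lemma Rintegrable2_mul u v :
  Rintegrable2 u -> Rintegrable2 v -> Rintegrable mu (fun x => u x * v x).
Proof.
move=> [mu_ ju] [mv jv]; apply: Rintegrable_le (RintegrableD ju jv).
  exact: measurable_funM.
move=> z; have := sqr_ge0 (u z + v z); have := sqr_ge0 (u z - v z).
rewrite ler_norml; nra.
Qed.

Lemma Rintegrable2D u v :
  Rintegrable2 u -> Rintegrable2 v -> Rintegrable2 (fun x => u x + v x).
Proof.
move=> u2 v2; split; first exact: measurable_funD u2.1 v2.1.
have := RintegrableD (RintegrableD u2.2 v2.2) (RintegrableZl 2 (Rintegrable2_mul u2 v2)).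
by apply: eq_Rintegrable => x; ring.
Qed.

Lemma Rintegrable2Zl k u : Rintegrable2 u -> Rintegrable2 (fun x => k * u x).
Proof.
move=> u2; split; first by apply: measurable_funM => //; exact: u2.1.
by have := RintegrableZl (k ^+ 2) u2.2; apply: eq_Rintegrable => x; ring.
Qed.

Lemma Rintegrable2B u v :
  Rintegrable2 u -> Rintegrable2 v -> Rintegrable2 (fun x => u x - v x).
Proof.
move=> u2 v2; have := Rintegrable2D u2 (Rintegrable2Zl (-1) v2).
by under eq_fun do rewrite mulN1r.
Qed.

Lemma Rintegral_sqrD_le u v : Rintegrable2 u -> Rintegrable2 v ->
  \int[mu]_x (u x + v x) ^+ 2 <=
  2 * \int[mu]_x (u x ^+ 2) + 2 * \int[mu]_x (v x ^+ 2).
Proof.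
move=> u2 v2; rewrite -!Rintegral_scale; [|exact: v2.2|exact: u2.2].
rewrite -Rintegral_add; [|exact: RintegrableZl u2.2|exact: RintegrableZl v2.2].
apply: Rintegral_le; first exact: (Rintegrable2D u2 v2).2.
  by apply: RintegrableD; apply: RintegrableZl; [exact: u2.2|exact: v2.2].
by move=> x; have := sqr_ge0 (u x - v x); nra.
Qed.

(** A weighted arithmetic-geometric inequality in place of Cauchy-Schwarz: a small [e] controls the
    first term for fixed [u], and the second is then small once [v] is. *)
Lemma Rintegral_mul_le u v (e : R) : 0 < e -> Rintegrable2 u -> Rintegrable2 v ->
  \int[mu]_x `|u x * v x| <=
  e * \int[mu]_x (u x ^+ 2) + e^-1 * \int[mu]_x (v x ^+ 2).
Proof.
move=> e0 u2 v2; rewrite -!Rintegral_scale; [|exact: v2.2|exact: u2.2].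
rewrite -Rintegral_add; [|exact: RintegrableZl u2.2|exact: RintegrableZl v2.2].
apply: Rintegral_le; first exact/Rintegrable_norm/Rintegrable2_mul.
  by apply: RintegrableD; apply: RintegrableZl; [exact: u2.2|exact: v2.2].
move=> x; rewrite -(ler_pM2l e0) mulrDr mulVKf ?gt_eqF// -{1}(gtr0_norm e0) -normrM.
have := sqr_ge0 (e * u x + v x); have := sqr_ge0 (e * u x - v x).
rewrite ler_norml; nra.
Qed.

Lemma cvg_Rintegral_mul u (v_ : nat -> T -> R) v : Rintegrable2 u ->
  (forall n, Rintegrable2 (fun x => v_ n x - v x)) ->
  \int[mu]_x ((v_ n x - v x) ^+ 2) @[n --> \oo] --> 0 ->
  \int[mu]_x `|u x * (v_ n x - v x)| @[n --> \oo] --> 0.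
Proof.
move=> u2 v2 cv; apply/cvgrPdist_lt => eps eps0.
have U0 : 0 <= \int[mu]_x (u x ^+ 2) by apply: Rintegral_ge0 => x _; exact: sqr_ge0.
(* This makes [e] times the integral of [u ^+ 2] at most [eps / 2]; the added 1 keeps the
   denominator positive when that integral is 0. *)
pose e := eps / (2 * (\int[mu]_x (u x ^+ 2) + 1)).
have e0 : 0 < e by rewrite divr_gt0// mulr_gt0// ltr_wpDl.
have ee0 : 0 < e * (eps / 2) by rewrite mulr_gt0// divr_gt0.
move/cvgrPdist_lt : cv => /(_ _ ee0) [N _ Nv]; exists N => // n Nn.
have := Nv n Nn; rewrite /= !sub0r !normrN.
rewrite !ger0_norm; last 2 first.
  by apply: Rintegral_ge0 => x _; exact: normr_ge0.
  by apply: Rintegral_ge0 => x _; exact: sqr_ge0.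
move=> h; apply: (le_lt_trans (Rintegral_mul_le e0 u2 (v2 n))).
rewrite [ltRHS](_ : _ = eps / 2 + eps / 2); last by field.
rewrite ler_ltD//; last by rewrite ltr_pdivrMl.
rewrite /e mulrAC ler_pdivrMr; last by rewrite mulr_gt0// ltr_wpDl.
by rewrite mulrA divfK// ler_wpM2l ?(ltW eps0)// lerDl.
Qed.

End square_integrable.

Section L2_completeness.
Context d (T : measurableType d) (R : realType).
Variable mu : {measure set T -> \bar R}.
Variable u_ : nat -> T -> R.
Hypothesis mu_ : forall n, measurable_fun setT (u_ n).
Hypothesis ju_ : forall n m, Rintegrable mu (fun x => (u_ n x - u_ m x) ^+ 2).
Hypothesis cauchy_u : forall e : R, 0 < e -> exists N, forall n m,
  (N <= n)%N -> (N <= m)%N -> \int[mu]_x ((u_ n x - u_ m x) ^+ 2) <= e.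

(** The start of the Riesz-Fischer argument. Partial sums of the thresholds are used because they
    are monotone. *)
Let extraction : exists M : nat -> nat, (forall k, M k <= M k.+1)%N /\
  forall k n m, (M k <= n)%N -> (M k <= m)%N ->
    \int[mu]_x ((u_ n x - u_ m x) ^+ 2) <= 8^-1 ^+ k.
Proof.
have h k : exists N, forall n m, (N <= n)%N -> (N <= m)%N ->
    \int[mu]_x ((u_ n x - u_ m x) ^+ 2) <= 8^-1 ^+ k.
  by apply: cauchy_u; rewrite exprn_gt0.
have /choice [N NP] := h.
exists (fun k => \sum_(i < k.+1) N i)%N; split.
  by move=> k; rewrite [leqRHS]big_ord_recr leq_addr.
move=> k n m kn km; apply: NP.
- by apply: leq_trans kn; rewrite big_ord_recr leq_addl.
- by apply: leq_trans km; rewrite big_ord_recr leq_addl.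
Qed.

(** Since [4 * 8^-1 = 2^-1], the integrals weighted by [4 ^+ k] are still summable. The weighted
    series is thus finite almost everywhere, and its sum bounds every term, so that the increments
    are of order [2^-1 ^+ k]. *)
Let ae_bound (v : nat -> T -> R) : (forall k, measurable_fun setT (v k)) ->
  (forall k, Rintegrable mu (fun x => (v k.+1 x - v k x) ^+ 2)) ->
  (forall k, \int[mu]_x ((v k.+1 x - v k x) ^+ 2) <= 8^-1 ^+ k) ->
  {ae mu, forall x, exists C : R, forall k, 4 ^+ k * (v k.+1 x - v k x) ^+ 2 <= C}.
Proof.
move=> mv jv v8.
pose f k x : \bar R := (4 ^+ k * (v k.+1 x - v k x) ^+ 2)%:E.
have mf k : measurable_fun setT (f k).
  apply/measurable_EFinP; apply: measurable_funM => //.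
  by apply: measurable_funX; exact: measurable_funB.
have f0 k x : setT x -> (0 <= f k x)%E.
  by move=> _; rewrite lee_fin mulr_ge0// ?sqr_ge0// exprn_ge0.
have fS : (\int[mu]_x (\sum_(0 <= k <oo) f k x) < +oo)%E.
  rewrite integral_nneseries//.
  apply: (@le_lt_trans _ _ (\sum_(0 <= k <oo) (geometric 1 2^-1 k)%:E)%E).
    apply: lee_nneseries => [k _ _|k _].
      by apply: integral_ge0 => x _; exact: f0.
    rewrite /f Rintegral_EFin; last exact: RintegrableZl.
    rewrite lee_fin Rintegral_scale//= mul1r.
    rewrite (_ : 2^-1 ^+ k = 4 ^+ k * 8^-1 ^+ k); last first.
      by rewrite -exprMn; congr (_ ^+ _); field.
    by rewrite ler_pM2l ?exprn_gt0.
  apply: (@le_lt_trans _ _ (1 * (1 - 2^-1)^-1)%:E); last exact: ltry.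
  apply: lime_le.
    by apply: is_cvg_nneseries => n _ _; rewrite lee_fin geometric_ge0.
  apply: nearW => n; rewrite sumEFin lee_fin.
  by apply: geometric_le_lim => //; rewrite ger0_norm// invf_lt1// ltr1n.
have jS : mu.-integrable setT (fun x => \sum_(0 <= k <oo) f k x)%E.
  apply/integrableP; split.
    by apply: ge0_emeasurable_sum => // k x _ _; exact: f0.
  rewrite (eq_integral (fun x => \sum_(0 <= k <oo) f k x)%E)// => x _.
  by rewrite gee0_abs// nneseries_ge0// => n _ _; exact: f0.
apply: filterS (integrable_ae measurableT jS) => x /(_ I) fx.
exists (fine (\sum_(0 <= k <oo) f k x)%E) => k.
rewrite -lee_fin fineK//.
apply: le_trans (nneseries_lim_ge k.+1 _); last by move=> n _ _; exact: f0.
rewrite big_nat_recr//= leeDr//; apply: sume_ge0 => i _; exact: f0.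
Qed.

Let cvg_geometric_increments (v : nat -> R) (C : R) :
  (forall k, 4 ^+ k * (v k.+1 - v k) ^+ 2 <= C) -> cvgn v.
Proof.
(* With [D] at least 1, [C <= D <= D ^+ 2], so the bound on the squared increments gives
   [D * 2^-1 ^+ k] without a square root of [C]. *)
move=> vC; pose D := Num.max C 1.
have D1 : 1 <= D by rewrite le_max lexx orbT.
have vD k : `|v k.+1 - v k| <= geometric D 2^-1 k.
  rewrite /= -(ler_pM2l (_ : 0 < 2 ^+ k)) ?exprn_gt0//.
  rewrite mulrCA -exprMn mulfV// expr1n mulr1.
  rewrite -(@ler_pXn2r _ 2)// ?nnegrE ?mulr_ge0 ?exprn_ge0//; last by lra.
  rewrite exprMn real_normK ?num_real// -exprM mulnC exprM.
  rewrite (_ : 2 ^+ 2 = 4); last by ring.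
  apply: (le_trans (vC k)); rewrite (@le_trans _ _ D) ?le_max ?lexx//; nra.
have cs : cvgn (series (fun k => v k.+1 - v k)).
  apply: normed_cvg; apply: series_le_cvg vD _ => //.
  - by move=> n; rewrite geometric_ge0//; lra.
  - by apply: is_cvg_geometric_series; rewrite ger0_norm// invf_lt1// ltr1n.
have -> : v = (fun n => series (fun k => v k.+1 - v k) n + v 0%N).
  apply/funext => n; elim: n => [|n IH].
    by rewrite /series/= big_geq// add0r.
  rewrite /series/= big_nat_recr//= {1}IH /series/=; ring.
by apply: is_cvgD => //; exact: is_cvg_cst.
Qed.

Lemma L2_complete : exists h : T -> R, [/\ measurable_fun setT h,
  (forall n, Rintegrable2 mu (fun x => u_ n x - h x)) &
  \int[mu]_x ((u_ n x - h x) ^+ 2) @[n --> \oo] --> 0].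
Proof.
have [M [Mnd Mu]] := extraction.
have Mle k l : (k <= l)%N -> (M k <= M l)%N.
  by move=> /subnK <-; elim: (l - k)%N => // n; move/leq_trans; apply; exact: Mnd.
pose v k := u_ (M k).
have mv k : measurable_fun setT (v k) by exact: mu_.
have cv : {ae mu, forall x, cvgn (v ^~ x)}.
  apply: filterS (ae_bound mv _ _) => [x [C xC]|k|k].
  - exact: cvg_geometric_increments xC.
  - exact: ju_.
  - exact: Mu.
(* The upper limit is measurable everywhere and equals the limit wherever the subsequence
   converges. *)
pose h x := fine (limn_esup (fun k => (v k x)%:E)).
have mh : measurable_fun setT h.
  apply: measurableT_comp => //.
  apply: (measurable_fun_limn_esup (f := fun n x => (v n x)%:E)) => n.
  exact/measurable_EFinP.
have vh : {ae mu, forall x, v k x @[k --> \oo] --> h x}.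
  apply: filterS cv => x /cvg_ex[l vl].
  rewrite /h; have /cvg_limn_einf_sup[_ ->] // : (v k x)%:E @[k --> \oo] --> l%:E.
  exact: cvg_comp vl _.
(* Fatou's lemma in the second index carries the Cauchy estimate between [u_ n] and the subsequence
   over to the limit [h]. *)
have key K n : (M K <= n)%N -> Rintegrable mu (fun x => (u_ n x - h x) ^+ 2) /\
    \int[mu]_x ((u_ n x - h x) ^+ 2) <= 8^-1 ^+ K.
  move=> Kn; apply: (@fatou_Rintegral _ _ R mu
    (fun k x => (u_ n x - v (k + K)%N x) ^+ 2)) => //.
  - by move=> k; exact: ju_.
  - by move=> k x; exact: sqr_ge0.
  - by apply: measurable_funX; exact: measurable_funB (mu_ n) mh.
  - by move=> x; exact: sqr_ge0.
  - apply: filterS vh => x vx; rewrite expr2.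
    under eq_fun do rewrite expr2.
    have h1 : u_ n x - v (k + K)%N x @[k --> \oo] --> u_ n x - h x.
      by apply: cvgB; [exact: cvg_cst|move: vx; rewrite -(cvg_shiftn K)].
    exact: cvgM.
  - by move=> k; apply: Mu => //; apply: Mle; rewrite leq_addl.
have h2 n : Rintegrable2 mu (fun x => u_ n x - h x).
  have h1 : Rintegrable2 mu (fun x => u_ (M 0%N) x - h x).
    by split; [exact: measurable_funB (mu_ _) mh|have [] := key 0%N (M 0%N)].
  have h2 : Rintegrable2 mu (fun x => u_ n x - u_ (M 0%N) x).
    by split; [exact: measurable_funB (mu_ _) (mu_ _)|exact: ju_].
  have := Rintegrable2D h2 h1; congr (Rintegrable2 mu _).
  by apply/funext => x; rewrite subrKA.
exists h; split => //.
apply/cvgrPdist_le => e e0.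
have [K Ke] : exists K : nat, 8^-1 ^+ K <= e.
  have : 8^-1 ^+ K @[K --> \oo] --> (0 : R).
    by apply: cvg_expr; rewrite ger0_norm// invf_lt1// ltr1n.
  move/cvgrPdist_le => /(_ _ e0) [K _ /(_ K (leqnn K))].
  by rewrite /= sub0r normrN ger0_norm ?exprn_ge0// => ?; exists K.
exists (M K) => // n Kn /=; rewrite sub0r normrN ger0_norm.
  by apply: le_trans Ke; have [] := key K n Kn.
by apply: Rintegral_ge0 => x _; exact: sqr_ge0.
Qed.

End L2_completeness.

(** * Quadratic energies of convolutions *)

(* Sigma-finiteness of a product measure is inferred canonically for subprobabilities only. *)
Definition sigma_finite_prod d1 d2 (T1 : measurableType d1) (T2 : measurableType d2)
    (R : realType) (m1 : {sigma_finite_measure set T1 -> \bar R})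
    (m2 : {sigma_finite_measure set T2 -> \bar R}) :
    {sigma_finite_measure set (T1 * T2)%type -> \bar R} :=
  HB.pack (m1 \x m2)%E (Measure_isSigmaFinite.Build _ _ _ (m1 \x m2)%E
    (lebesgue_integral_fubini.product_measure_sigma_finite_subproof m1 m2)).

Section convolution_energy.
Context (R : realType).
Local Notation mu := (@lebesgue_measure R).
Local Notation mu2 := (sigma_finite_prod mu mu).
Implicit Types k g : R -> R.

Definition convol k g (x : R) : R := \int[mu]_y (k (x - y) * g y).

Lemma measurable_fun_comp_sub d (T : measurableType d) k (f1 f2 : T -> R) :
  measurable_fun (setT : set R) k -> measurable_fun setT f1 ->
  measurable_fun setT f2 -> measurable_fun setT (fun t => k (f1 t - f2 t)).
Proof.
by move=> mk m1 m2; apply: measurableT_comp => //; exact: measurable_funB.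
Qed.

Lemma measurable_convol k g : measurable_fun (setT : set R) k ->
  measurable_fun (setT : set R) g -> measurable_fun (setT : set R) (convol k g).
Proof.
move=> mk mg.
apply: (@measurable_Rintegral2 _ _ _ _ R mu (fun z : R * R => k (z.1 - z.2) * g z.2)).
apply: measurable_funM; last exact: measurable_snd_comp.
by apply: measurable_fun_comp_sub.
Qed.

Lemma Rintegrable2_reflect k x : Rintegrable2 mu k ->
  Rintegrable2 mu (fun y => k (x - y)).
Proof.
move=> [mk jk]; split; last exact: (Rintegrable_reflect x jk).
by apply: measurable_fun_comp_sub => //; exact: measurable_cst.
Qed.

Lemma Rintegrable2_shift k x : Rintegrable2 mu k ->
  Rintegrable2 mu (fun y => k (y - x)).
Proof.
move=> [mk jk]; split; last exact: (Rintegrable_shift x jk).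
by apply: measurable_fun_comp_sub => //; exact: measurable_cst.
Qed.

Lemma Rintegrable_convol k g x : Rintegrable2 mu k -> Rintegrable2 mu g ->
  Rintegrable mu (fun y => k (x - y) * g y).
Proof. by move=> k2 g2; apply: Rintegrable2_mul => //; exact: Rintegrable2_reflect. Qed.

Section kernel.
Variables (k g : R -> R).
Hypotheses (k1 : Rintegrable mu k) (k2 : Rintegrable2 mu k) (g2 : Rintegrable2 mu g).

Let mk := Rintegrable_measurable k1.
Let mg := g2.1.
Let N : R := \int[mu]_x `|k x|.

(** The autocorrelation of [|k|]. It is symmetric, and integrating out either variable leaves
    [N ^+ 2]. *)
Let corr (x y : R) : R := \int[mu]_z (`|k (z - x)| * `|k (z - y)|).

Let jk2 x y : Rintegrable mu (fun z => k (z - x) * k (z - y)).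
Proof. by apply: Rintegrable2_mul; exact: Rintegrable2_shift. Qed.

Let jcorr x y : Rintegrable mu (fun z => `|k (z - x)| * `|k (z - y)|).
Proof.
by have := Rintegrable_norm (jk2 x y); apply: eq_Rintegrable => z; rewrite normrM.
Qed.

Let corrC x y : corr x y = corr y x.
Proof. by apply: eqT_Rintegral => z; rewrite mulrC. Qed.

Let corr_ge0 x y : 0 <= corr x y.
Proof. by apply: Rintegral_ge0 => z _; rewrite mulr_ge0. Qed.

Let mnk d (T : measurableType d) (f1 f2 : T -> R) : measurable_fun setT f1 ->
  measurable_fun setT f2 -> measurable_fun setT (fun t => `|k (f1 t - f2 t)|).
Proof.
by move=> m1 m2; apply: (@measurable_fun_comp_sub _ T (fun x => `|k x|)) => //;
  exact: measurableT_comp.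
Qed.

Let jcorr_sec x : Rintegrable (mu \x mu)%E (fun t : R * R => `|k (t.2 - x)| * `|k (t.2 - t.1)|).
Proof.
apply: (@Rintegrable_prod2 _ _ _ _ R mu mu _ (fun z => `|k (z - x)| * N)) => //=.
- by apply: measurable_funM; apply: mnk => //; exact: measurable_cst.
- move=> z; apply: RintegrableZl; apply: Rintegrable_norm.
  exact: (Rintegrable_reflect z k1).
- move=> z; rewrite le_eqVlt; apply/orP; left; apply/eqP.
  under eq_fun do rewrite ger0_norm ?mulr_ge0//.
  rewrite Rintegral_scale; last exact/Rintegrable_norm/(Rintegrable_reflect z k1).
  by congr (_ * _); rewrite (Rintegral_reflect z (Rintegrable_norm k1)).
- by apply: RintegrableZr; exact: (Rintegrable_shift x (Rintegrable_norm k1)).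
Qed.

Let jcorr1 x : Rintegrable mu (corr x).
Proof. exact: (Rintegrable_fubini1 (jcorr_sec x)). Qed.

Let int_corr x : \int[mu]_y corr x y = N ^+ 2.
Proof.
rewrite /corr (Rfubini (jcorr_sec x)) /=.
under eq_fun => z.
  rewrite Rintegral_scale; last exact/Rintegrable_norm/(Rintegrable_reflect z k1).
  rewrite (Rintegral_reflect z (Rintegrable_norm k1)) -/N mulrC.
  over.
rewrite Rintegral_scale; last exact: (Rintegrable_shift x (Rintegrable_norm k1)).
by rewrite (Rintegral_shift x (Rintegrable_norm k1)) -/N expr2.
Qed.

Let mcorr : measurable_fun setT (fun w : R * R => corr w.1 w.2).
Proof.
apply: (@measurable_Rintegral2 _ _ _ _ R mu
  (fun t : (R * R) * R => `|k (t.2 - t.1.1)| * `|k (t.2 - t.1.2)|)).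
apply: measurable_funM; apply: mnk => //.
- exact: (measurableT_comp measurable_fst measurable_fst).
- exact: (measurableT_comp measurable_snd measurable_fst).
Qed.

Let jg1 : Rintegrable (mu \x mu)%E (fun w : R * R => g w.1 ^+ 2 * corr w.1 w.2).
Proof.
apply: (@Rintegrable_prod1 _ _ _ _ R mu mu _ (fun x => N ^+ 2 * g x ^+ 2)) => //=.
- apply: measurable_funM; last exact: mcorr.
  by apply: measurable_funX; exact: (measurable_fst_comp mg).
- by move=> x; exact: (RintegrableZl _ (jcorr1 x)).
- move=> x; under eq_fun do rewrite (ger0_norm (mulr_ge0 (sqr_ge0 _) (corr_ge0 _ _))).
  by rewrite Rintegral_scale// int_corr mulrC.
- exact: RintegrableZl g2.2.
Qed.

Let jg2 : Rintegrable (mu \x mu)%E (fun w : R * R => g w.2 ^+ 2 * corr w.1 w.2).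
Proof.
apply: (@Rintegrable_prod2 _ _ _ _ R mu mu _ (fun x => N ^+ 2 * g x ^+ 2)) => //=.
- apply: measurable_funM; last exact: mcorr.
  by apply: measurable_funX; exact: (measurable_snd_comp mg).
- move=> y; under eq_fun do rewrite corrC; exact: (RintegrableZl _ (jcorr1 y)).
- move=> y; under eq_fun do rewrite (ger0_norm (mulr_ge0 (sqr_ge0 _) (corr_ge0 _ _))) corrC.
  by rewrite Rintegral_scale// int_corr mulrC.
- exact: RintegrableZl g2.2.
Qed.

(** Integrating out the first variable leaves [corr] times the product of two values of [g], at most
    the sum of their squares; the marginals of [corr] then give a finite bound. This is Young's
    inequality for L^1 convolved with L^2, in a form that also licenses Fubini. *)
Lemma Rintegrable_energy : Rintegrable (mu \x mu2)%E
  (fun t : R * (R * R) => k (t.1 - t.2.1) * k (t.1 - t.2.2) * (g t.2.1 * g t.2.2)).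
Proof.
apply: (@Rintegrable_prod2 _ _ _ _ R mu mu2 _ (fun w : R * R =>
   g w.1 ^+ 2 * corr w.1 w.2 + g w.2 ^+ 2 * corr w.1 w.2)) => /=.
- have m21 : measurable_fun setT (fun t : R * (R * R) => t.2.1).
    exact: measurableT_comp measurable_fst measurable_snd.
  have m22 : measurable_fun setT (fun t : R * (R * R) => t.2.2).
    exact: measurableT_comp measurable_snd measurable_snd.
  apply: measurable_funM; apply: measurable_funM.
  + exact: measurable_fun_comp_sub.
  + exact: measurable_fun_comp_sub.
  + exact: measurableT_comp mg m21.
  + exact: measurableT_comp mg m22.
- by move=> w; exact: RintegrableZr.
- move=> w; under eq_fun do rewrite normrM mulrC normrM.
  under eq_fun do rewrite [in X in _ * X]normrM.
  rewrite Rintegral_scale; last exact: jcorr.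
  rewrite -mulrDl ler_wpM2r ?corr_ge0// -normrM.
  have := sqr_ge0 (g w.1 - g w.2); have := sqr_ge0 (g w.1 + g w.2).
  rewrite ler_norml; nra.
- exact: RintegrableD jg1 jg2.
Qed.

Lemma sqr_convolE z : convol k g z ^+ 2 = \int[(mu \x mu)%E]_w
  (k (z - w.1) * k (z - w.2) * (g w.1 * g w.2)).
Proof.
have j := Rintegrable_convol z k2 g2.
under [RHS]eqT_Rintegral do rewrite mulrACA.
rewrite -(Rfubini1 (Rintegrable_tensor j j))/= expr2.
under [RHS]eqT_Rintegral do rewrite Rintegral_scale//.
under [RHS]eqT_Rintegral do rewrite mulrC.
by rewrite Rintegral_scale.
Qed.

Lemma Rintegrable2_convol : Rintegrable2 mu (convol k g).
Proof.
split; first exact: measurable_convol.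
have := Rintegrable_fubini1 Rintegrable_energy.
by apply: eq_Rintegrable => z; rewrite sqr_convolE.
Qed.

End kernel.

(** Expand the squares and integrate [z] out first. The two kernels are treated together because
    [poisson_convolution] evaluates their autocorrelations only jointly. *)
Lemma convol_energy k1 k2 g (kap : R -> R -> R) :
  Rintegrable mu k1 -> Rintegrable2 mu k1 ->
  Rintegrable mu k2 -> Rintegrable2 mu k2 -> Rintegrable2 mu g ->
  (forall x y, \int[mu]_z (k1 (z - x) * k1 (z - y) + k2 (z - x) * k2 (z - y)) = kap x y) ->
  \int[mu]_z (convol k1 g z ^+ 2) + \int[mu]_z (convol k2 g z ^+ 2) =
  \int[(mu \x mu)%E]_w (g w.1 * g w.2 * kap w.1 w.2).
Proof.
move=> j1 j1' j2 j2' g2 kapE.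
have J1 := Rintegrable_energy j1 j1' g2; have J2 := Rintegrable_energy j2 j2' g2.
under [X in X + _]eqT_Rintegral do rewrite sqr_convolE//.
under [X in _ + X]eqT_Rintegral do rewrite sqr_convolE//.
rewrite (Rfubini1 J1) (Rfubini1 J2) -(Rintegral_add J1 J2).
rewrite -(Rfubini2 (RintegrableD J1 J2))/=.
apply: eqT_Rintegral => w; rewrite -kapE -Rintegral_scale.
  by apply: eqT_Rintegral => z; ring.
by apply: RintegrableD; apply: Rintegrable2_mul; exact: Rintegrable2_shift.
Qed.

End convolution_energy.

Section hilbert_energy.
Context (R : realType).
Local Notation mu := (@lebesgue_measure R).
Local Notation mu2 := (sigma_finite_prod mu mu).
Implicit Types (s t x y z : R) (g : R -> R).

Lemma Rintegrable2_poisson s : 0 < s -> Rintegrable2 mu (poisson s).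
Proof.
by move=> s0; split; [exact: measurable_poisson|exact: Rintegrable_poisson_sqr].
Qed.

Lemma Rintegrable2_cpoisson s : 0 < s -> Rintegrable2 mu (cpoisson s).
Proof.
by move=> s0; split; [exact: measurable_cpoisson|exact: Rintegrable_cpoisson_sqr].
Qed.

(** The tails [1 / z] cancel: a common denominator leaves [t ^+ 2 - s ^+ 2] times [cpoisson s z],
    which is bounded by [s^-1], over [z ^+ 2 + t ^+ 2]. *)
Lemma Rintegrable_cpoissonB s t : 0 < s -> 0 < t ->
  Rintegrable mu (fun z => cpoisson s z - cpoisson t z).
Proof.
move=> s0 t0.
apply: Rintegrable_le (RintegrableZl (`|t ^+ 2 - s ^+ 2| / (s * t)) (Rintegrable_poisson t0)).
  exact: measurable_funB (measurable_cpoisson s0) (measurable_cpoisson t0).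
move=> z; have ds := poisson_den_gt0 z s0; have dt := poisson_den_gt0 z t0.
have -> : cpoisson s z - cpoisson t z =
    (t ^+ 2 - s ^+ 2) * (z / (z ^+ 2 + s ^+ 2)) / (z ^+ 2 + t ^+ 2).
  by rewrite /cpoisson; field; rewrite !gt_eqF.
have zs : `|z / (z ^+ 2 + s ^+ 2)| <= s^-1.
  rewrite normrM normfV (gtr0_norm ds) ler_pdivrMr// ler_pdivlMl//.
  rewrite -{1}(gtr0_norm s0) -normrM ler_norml.
  have := sqr_ge0 (s - z); have := sqr_ge0 (s + z); nra.
rewrite /poisson normrM normrM normfV (gtr0_norm dt).
rewrite [leRHS](_ : _ = `|t ^+ 2 - s ^+ 2| * s^-1 / (z ^+ 2 + t ^+ 2)); last first.
  by field; rewrite !gt_eqF.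
by rewrite ler_wpM2r ?invr_ge0 ?(ltW dt)// ler_wpM2l.
Qed.

Lemma Rintegrable_poissonB s t : 0 < s -> 0 < t ->
  Rintegrable mu (fun z => poisson s z - poisson t z).
Proof. by move=> s0 t0; apply: RintegrableB; exact: Rintegrable_poisson. Qed.

Definition poisson_energy g s : R :=
  \int[mu2]_w (g w.1 * g w.2 * poisson s (w.1 - w.2)).

Lemma Rintegrable_poisson_energy g s : Rintegrable2 mu g -> 0 < s ->
  Rintegrable mu2 (fun w : R * R => g w.1 * g w.2 * poisson s (w.1 - w.2)) /\
  `|poisson_energy g s| <= 2 * (pi * \int[mu]_x (g x ^+ 2)).
Proof.
move=> g2 s0; have mg := g2.1.
have mp : measurable_fun setT (fun w : R * R => poisson s (w.1 - w.2)).
  by apply: measurable_fun_comp_sub => //; exact: measurable_poisson.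
have j1 : Rintegrable mu2 (fun w : R * R => g w.1 ^+ 2 * poisson s (w.1 - w.2)).
  apply: (@Rintegrable_prod1 _ _ _ _ R mu mu _ (fun x => pi * g x ^+ 2)) => /=.
  - by apply: measurable_funM => //; apply: measurable_funX; exact: (measurable_fst_comp mg).
  - by move=> x; exact: (RintegrableZl _ (Rintegrable_reflect x (Rintegrable_poisson s0))).
  - move=> x; under eq_fun do rewrite (ger0_norm (mulr_ge0 (sqr_ge0 _) (poisson_ge0 _ s0))).
    rewrite Rintegral_scale; last exact: (Rintegrable_reflect x (Rintegrable_poisson s0)).
    by rewrite (Rintegral_reflect x (Rintegrable_poisson s0)) Rintegral_poisson// mulrC.
  - exact: RintegrableZl g2.2.
have i1 : \int[mu2]_w (g w.1 ^+ 2 * poisson s (w.1 - w.2)) = pi * \int[mu]_x (g x ^+ 2).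
  rewrite -(Rfubini1 (m1 := mu) (m2 := mu) j1)/= -Rintegral_scale; last exact: g2.2.
  apply: eqT_Rintegral => x.
  rewrite Rintegral_scale; last exact: (Rintegrable_reflect x (Rintegrable_poisson s0)).
  by rewrite (Rintegral_reflect x (Rintegrable_poisson s0)) Rintegral_poisson// mulrC.
have j2 : Rintegrable mu2 (fun w : R * R => g w.2 ^+ 2 * poisson s (w.1 - w.2)).
  apply: (@Rintegrable_prod2 _ _ _ _ R mu mu _ (fun x => pi * g x ^+ 2)) => /=.
  - by apply: measurable_funM => //; apply: measurable_funX; exact: (measurable_snd_comp mg).
  - by move=> x; exact: (RintegrableZl _ (Rintegrable_shift x (Rintegrable_poisson s0))).
  - move=> x; under eq_fun do rewrite (ger0_norm (mulr_ge0 (sqr_ge0 _) (poisson_ge0 _ s0))).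
    rewrite Rintegral_scale; last exact: (Rintegrable_shift x (Rintegrable_poisson s0)).
    by rewrite (Rintegral_shift x (Rintegrable_poisson s0)) Rintegral_poisson// mulrC.
  - exact: RintegrableZl g2.2.
have i2 : \int[mu2]_w (g w.2 ^+ 2 * poisson s (w.1 - w.2)) = pi * \int[mu]_x (g x ^+ 2).
  rewrite -(Rfubini2 (m1 := mu) (m2 := mu) j2)/= -Rintegral_scale; last exact: g2.2.
  apply: eqT_Rintegral => x.
  rewrite Rintegral_scale; last exact: (Rintegrable_shift x (Rintegrable_poisson s0)).
  by rewrite (Rintegral_shift x (Rintegrable_poisson s0)) Rintegral_poisson// mulrC.
have le12 w : `|g w.1 * g w.2 * poisson s (w.1 - w.2)| <=
    g w.1 ^+ 2 * poisson s (w.1 - w.2) + g w.2 ^+ 2 * poisson s (w.1 - w.2).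
  rewrite normrM (ger0_norm (poisson_ge0 _ s0)) -mulrDl ler_wpM2r ?poisson_ge0//.
  have := sqr_ge0 (g w.1 - g w.2); have := sqr_ge0 (g w.1 + g w.2).
  rewrite ler_norml; nra.
have j : Rintegrable mu2 (fun w : R * R => g w.1 * g w.2 * poisson s (w.1 - w.2)).
  apply: (@Rintegrable_le _ _ _ mu2 _ _ _ le12 (RintegrableD j1 j2)).
  apply: measurable_funM => //; apply: measurable_funM.
    exact: (measurable_fst_comp mg).
  exact: (measurable_snd_comp mg).
split => //; apply: (le_trans (Rintegral_norm j)).
rewrite mulr2n mulrDl !mul1r -{1}i1 -i2 -(Rintegral_add j1 j2).
apply: Rintegral_le; [exact: Rintegrable_norm|exact: RintegrableD|exact: le12].
Qed.

(** Because [cpoisson] is odd and [poisson] even, the sum of the two autocorrelations is minus the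
    combination in [poisson_convolution], applied to each of the four pairs of scales. *)
Lemma conjugate_energy g s t : Rintegrable2 mu g -> 0 < s -> 0 < t ->
  \int[mu]_z (convol (fun z => cpoisson s z - cpoisson t z) g z ^+ 2) +
  \int[mu]_z (convol (fun z => poisson s z - poisson t z) g z ^+ 2) =
  2 * pi * (poisson_energy g (s + s) - 2 * poisson_energy g (s + t) +
            poisson_energy g (t + t)).
Proof.
move=> g2 s0 t0.
have ss := addr_gt0 s0 s0; have st := addr_gt0 s0 t0; have tt := addr_gt0 t0 t0.
have jq : Rintegrable2 mu (fun z => cpoisson s z - cpoisson t z).
  by apply: Rintegrable2B; exact: Rintegrable2_cpoisson.
have jp : Rintegrable2 mu (fun z => poisson s z - poisson t z).
  by apply: Rintegrable2B; exact: Rintegrable2_poisson.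
rewrite (convol_energy (Rintegrable_cpoissonB s0 t0) jq (Rintegrable_poissonB s0 t0) jp
  g2 (kap := fun x y => 2 * pi * (poisson (s + s) (x - y) -
    2 * poisson (s + t) (x - y) + poisson (t + t) (x - y)))).
  have [jss _] := Rintegrable_poisson_energy g2 ss.
  have [jst _] := Rintegrable_poisson_energy g2 st.
  have [jtt _] := Rintegrable_poisson_energy g2 tt.
  rewrite /poisson_energy -(Rintegral_scale 2 jst) -Rintegral_sub//; last exact: RintegrableZl.
  rewrite -Rintegral_add//; last by apply: RintegrableB => //; exact: RintegrableZl.
  rewrite -Rintegral_scale; last first.
    by apply: RintegrableD => //; apply: RintegrableB => //; exact: RintegrableZl.
  by apply: eqT_Rintegral => w; ring.
move=> x y; set v := x - y.
pose E a b w := cpoisson a (v - w) * cpoisson b w - poisson a (v - w) * poisson b w.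
have jE a b : 0 < a -> 0 < b -> Rintegrable mu (E a b).
  move=> a0 b0; apply: RintegrableB; apply: Rintegrable2_mul.
  - exact: (Rintegrable2_reflect v (Rintegrable2_cpoisson a0)).
  - exact: Rintegrable2_cpoisson.
  - exact: (Rintegrable2_reflect v (Rintegrable2_poisson a0)).
  - exact: Rintegrable2_poisson.
have iE a b : 0 < a -> 0 < b -> \int[mu]_w E a b w = - (2 * pi * poisson (a + b) v).
  by move=> a0 b0; exact: poisson_convolution.
pose f w := E s t w + E t s w - E s s w - E t t w.
transitivity (\int[mu]_z f (z - y)).
  apply: eqT_Rintegral => z; rewrite /f /E.
  have -> : v - (z - y) = - (z - x) by rewrite /v; ring.
  by rewrite !cpoissonN !poissonN; ring.
have jst : Rintegrable mu (fun w => E s t w + E t s w) by apply: RintegrableD; exact: jE.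
have jsts : Rintegrable mu (fun w => E s t w + E t s w - E s s w).
  by apply: RintegrableB => //; exact: jE.
rewrite Rintegral_shift; last by apply: RintegrableB => //; exact: jE.
rewrite /f (Rintegral_sub jsts (jE _ _ t0 t0)) (Rintegral_sub jst (jE _ _ s0 s0)).
rewrite (Rintegral_add (jE _ _ s0 t0) (jE _ _ t0 s0)).
by rewrite !iE// (addrC t s); ring.
Qed.

End hilbert_energy.

(** * The mean-square limit of the truncated Hilbert transforms *)

Section midpoint_convex.
Context (R : realType).
Variables (F : R -> R) (B : R).
Hypothesis F_bounded : forall s, 0 < s -> `|F s| <= B.
Hypothesis F_convex : forall s t, 0 < s -> 0 < t -> 2 * F (s + t) <= F (s + s) + F (t + t).

(* An increase of [F] over one step would repeat at every later step of the
   same length, contradicting boundedness. *)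
Lemma midpoint_convex_nonincreasing u v : 0 < u -> u <= v -> F v <= F u.
Proof.
move=> u0 uv; rewrite leNgt; apply/negP => Fuv.
pose h := v - u; have h0 : 0 <= h by rewrite subr_ge0.
pose x n := u + n%:R * h.
have x0 n : 0 < x n by rewrite ltr_pwDl// mulr_ge0.
have incr n : F v - F u <= F (x n.+1) - F (x n).
  elim: n => [|n IH].
    have -> : x 1%N = v by rewrite /x /h; ring.
    by rewrite /x mul0r addr0.
  apply: (le_trans IH).
  have := @F_convex (x n / 2) (x n.+2 / 2).
  have -> : x n / 2 + x n.+2 / 2 = x n.+1.
    by rewrite /x -[n.+2%:R]natr1 -[n.+1%:R]natr1; field.
  rewrite -!splitr !divr_gt0// => /(_ isT isT); lra.
have lin n : F u + n%:R * (F v - F u) <= F (x n).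
  elim: n => [|n IH]; first by rewrite /x !mul0r !addr0.
  by have := incr n; rewrite -natr1 mulrDl mul1r; lra.
have [n nB] : exists n : nat, 2 * B < n%:R * (F v - F u).
  have d0 : 0 < F v - F u by rewrite subr_gt0.
  exists (Num.truncn (2 * B / (F v - F u))).+1.
  rewrite -ltr_pdivrMr//; exact: truncnS_gt.
have := lin n; have := F_bounded u0; have := F_bounded (x0 n).
rewrite !ler_norml; lra.
Qed.

(** By monotonicity the limit at 0 is the supremum, so any [d] at which [F] comes within [e] of it
    serves. As [u] and [v] are interchangeable, the one-sided bound is two-sided. *)
Lemma midpoint_convex_cauchy0 e : 0 < e -> exists2 d, 0 < d &
  forall u v, 0 < u -> u <= d -> 0 < v -> v <= d -> F u - F v <= e.
Proof.
move=> e0; pose A := [set F u | u in [set u : R | 0 < u]].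
have supA : has_sup A.
  split; first by exists (F 1), 1 => //=.
  by exists B => _ [u /= u0 <-]; have := F_bounded u0; rewrite ler_norml; lra.
have [_ [d /= d0 <-] dA] := sup_adherent e0 supA.
exists d => // u v u0 ud v0 vd.
have : F u <= sup A by apply: ub_le_sup; [case: supA|exists u].
have := midpoint_convex_nonincreasing v0 vd; lra.
Qed.

Lemma midpoint_convex_cauchyy e : 0 < e -> exists2 d, 0 < d &
  forall u v, d <= u -> d <= v -> F u - F v <= e.
Proof.
move=> e0; pose A := [set F u | u in [set u : R | 0 < u]].
have infA : has_inf A.
  split; first by exists (F 1), 1 => //=.
  by exists (- B) => _ [u /= u0 <-]; have := F_bounded u0; rewrite ler_norml; lra.
have [_ [d /= d0 <-] dA] := inf_adherent e0 infA.
exists d => // u v du dv.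
have : inf A <= F v by apply: ge_inf; [case: infA|exists v => //=; exact: lt_le_trans dv].
have := midpoint_convex_nonincreasing d0 du; lra.
Qed.

End midpoint_convex.

Section hilbert_L2.
Context (R : realType).
Local Notation mu := (@lebesgue_measure R).
Implicit Types (s t x y z : R) (g k : R -> R).

Lemma convolB k1 k2 g x :
  Rintegrable2 mu k1 -> Rintegrable2 mu k2 -> Rintegrable2 mu g ->
  convol (fun z => k1 z - k2 z) g x = convol k1 g x - convol k2 g x.
Proof.
move=> k12 k22 g2; rewrite /convol -Rintegral_sub; [|exact: Rintegrable_convol..].
by apply: eqT_Rintegral => y; rewrite mulrBl.
Qed.

(* The kernel [cpoisson s] itself is not integrable at infinity. *)
Definition trunc_kernel (n : nat) z : R := cpoisson n.+1%:R^-1 z - cpoisson n.+1%:R z.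

Lemma Rintegrable_trunc_kernel n : Rintegrable mu (trunc_kernel n).
Proof. by apply: Rintegrable_cpoissonB; rewrite ?invr_gt0. Qed.

Lemma Rintegrable2_trunc_kernel n : Rintegrable2 mu (trunc_kernel n).
Proof. by apply: Rintegrable2B; apply: Rintegrable2_cpoisson; rewrite ?invr_gt0. Qed.

Section conjugate_limit.
Variable g : R -> R.
Hypothesis g2 : Rintegrable2 mu g.

Let F := poisson_energy g.

Let FB s : 0 < s -> `|F s| <= 2 * (pi * \int[mu]_x (g x ^+ 2)).
Proof. by move=> s0; have [_] := Rintegrable_poisson_energy g2 s0. Qed.

Let dconvol s t z := convol (fun z => cpoisson s z - cpoisson t z) g z.

Let dconvol2 s t : 0 < s -> 0 < t -> Rintegrable2 mu (dconvol s t).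
Proof.
move=> s0 t0; apply: Rintegrable2_convol => //; first exact: Rintegrable_cpoissonB.
by apply: Rintegrable2B; exact: Rintegrable2_cpoisson.
Qed.

Let energy_le s t : 0 < s -> 0 < t -> \int[mu]_z (dconvol s t z ^+ 2) <=
  2 * pi * (F (s + s) - 2 * F (s + t) + F (t + t)).
Proof.
move=> s0 t0; rewrite -conjugate_energy// lerDl.
by apply: Rintegral_ge0 => x _; exact: sqr_ge0.
Qed.

Let F_convex s t : 0 < s -> 0 < t -> 2 * F (s + t) <= F (s + s) + F (t + t).
Proof.
move=> s0 t0; have : 0 <= 2 * pi * (F (s + s) - 2 * F (s + t) + F (t + t)).
  by apply: le_trans (energy_le s0 t0); apply: Rintegral_ge0 => x _; exact: sqr_ge0.
by rewrite pmulr_rge0 ?mulr_gt0 ?pi_gt0//; lra.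
Qed.

Let energy_cauchy e : 0 < e -> exists N : nat, forall n m, (N <= n)%N -> (N <= m)%N ->
  \int[mu]_z (dconvol n.+1%:R^-1 m.+1%:R^-1 z ^+ 2) <= e /\
  \int[mu]_z (dconvol n.+1%:R m.+1%:R z ^+ 2) <= e.
Proof.
(* The second difference is [F (s + s) - F (s + t)] plus [F (t + t) - F (s + t)]; each is at most
   [e'], and the prefactor is [2 * pi]. *)
move=> e0; pose e' := e / (4 * pi).
have e'0 : 0 < e' by rewrite divr_gt0// mulr_gt0// pi_gt0.
have [d0 d00 H0] := midpoint_convex_cauchy0 FB F_convex e'0.
have [d1 d10 H1] := midpoint_convex_cauchyy FB F_convex e'0.
have pp : 0 < 2 * pi :> R by rewrite mulr_gt0// pi_gt0.
have p0 : pi != 0 :> R by rewrite gt_eqF// pi_gt0.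
have ee : 2 * pi * (e' + e') = e.
  by rewrite /e'; move: p0; move: (pi : R) => P p0; field.
(* [2 / d0] rather than [1 / d0], because [F] is evaluated at sums of two scales, each of which must
   be at most [d0 / 2]. *)
exists (maxn (Num.truncn (2 / d0)).+1 (Num.truncn d1).+1) => n m.
rewrite !geq_max => /andP[n0 n1] /andP[m0 m1].
have small (k : nat) : (Num.truncn (2 / d0) < k)%N -> k.+1%:R^-1 <= d0 / 2.
  move=> kn; rewrite -[leRHS]invrK invf_div lef_pV2 ?posrE ?divr_gt0//.
  rewrite (le_trans (ltW (truncnS_gt _)))// ler_nat; exact: ltnW.
have big (k : nat) : (Num.truncn d1 < k)%N -> d1 <= k.+1%:R.
  move=> kn; rewrite (le_trans (ltW (truncnS_gt _)))// ler_nat; exact: ltnW.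
have i0 (k : nat) : 0 < k.+1%:R^-1 :> R by rewrite invr_gt0.
have := small n n0; have := small m m0; have := big n n1; have := big m m1.
have := i0 n; have := i0 m.
set a := n.+1%:R^-1; set b := m.+1%:R^-1.
have : 0 < n.+1%:R :> R by []. have : 0 < m.+1%:R :> R by [].
move: n.+1%:R m.+1%:R => c d d00' c00 b00 a00 d1d d1c bd ad.
split; apply: (le_trans (energy_le _ _)) => //; rewrite -ee ler_pM2l//.
- have := H0 (a + a) (a + b); have := H0 (b + b) (a + b).
  have -> : (0 < a + a) by lra. have -> : (0 < b + b) by lra. have -> : (0 < a + b) by lra.
  have -> : (a + a <= d0) by lra. have -> : (b + b <= d0) by lra. have -> : (a + b <= d0) by lra.
  by move=> /(_ isT isT isT isT) + /(_ isT isT isT isT); lra.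
- have := H1 (c + c) (c + d); have := H1 (d + d) (c + d).
  have -> : (d1 <= c + c) by lra. have -> : (d1 <= d + d) by lra. have -> : (d1 <= c + d) by lra.
  by move=> /(_ isT isT) + /(_ isT isT); lra.
Qed.

Let convol_trunc2 n : Rintegrable2 mu (convol (trunc_kernel n) g).
Proof.
apply: Rintegrable2_convol => //; first exact: Rintegrable_trunc_kernel.
exact: Rintegrable2_trunc_kernel.
Qed.

Lemma convol_trunc_kernelE n z : convol (trunc_kernel n) g z =
  convol (cpoisson n.+1%:R^-1) g z - convol (cpoisson n.+1%:R) g z.
Proof. by rewrite -convolB//; apply: Rintegrable2_cpoisson; rewrite ?invr_gt0. Qed.

Let convol_trunc_cauchy e : 0 < e -> exists N, forall n m,
  (N <= n)%N -> (N <= m)%N ->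
  \int[mu]_x ((convol (trunc_kernel n) g x - convol (trunc_kernel m) g x) ^+ 2) <= e.
Proof.
move=> e0; have e40 : 0 < e / 4 by rewrite divr_gt0.
have [N NP] := energy_cauchy e40.
exists N => n m Nn Nm; have [E1 E2] := NP n m Nn Nm.
(* Regroup by scale: one difference of small scales, governed by the limit of [F] at 0, and one of
   large scales, governed by its limit at infinity. *)
have -> : \int[mu]_x ((convol (trunc_kernel n) g x - convol (trunc_kernel m) g x) ^+ 2) =
   \int[mu]_x ((dconvol n.+1%:R^-1 m.+1%:R^-1 x + (-1) * dconvol n.+1%:R m.+1%:R x) ^+ 2).
  apply: eqT_Rintegral => x; rewrite !convol_trunc_kernelE /dconvol.
  by rewrite !convolB; [ring|..] => //; apply: Rintegrable2_cpoisson; rewrite ?invr_gt0.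
have D1 : Rintegrable2 mu (dconvol n.+1%:R^-1 m.+1%:R^-1).
  by apply: dconvol2; rewrite invr_gt0.
have D2 : Rintegrable2 mu (dconvol n.+1%:R m.+1%:R) by exact: dconvol2.
apply: (le_trans (Rintegral_sqrD_le D1 (Rintegrable2Zl (-1) D2))).
under [X in 2 * _ + 2 * X]eqT_Rintegral do rewrite mulN1r sqrrN.
apply: (@le_trans _ _ (2 * (e / 4) + 2 * (e / 4))).
  exact: (lerD (ler_wpM2l (ler0n _ 2) E1) (ler_wpM2l (ler0n _ 2) E2)).
by rewrite le_eqVlt; apply/orP; left; apply/eqP; field.
Qed.

Lemma convol_trunc_kernel_limit : exists h : R -> R, [/\ Rintegrable2 mu h,
  (forall n, Rintegrable2 mu (fun x => convol (trunc_kernel n) g x - h x)) &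
  \int[mu]_x ((convol (trunc_kernel n) g x - h x) ^+ 2) @[n --> \oo] --> 0].
Proof.
have [|||h [mh h2 ch]] := @L2_complete _ _ R mu (fun n => convol (trunc_kernel n) g).
- by move=> n; exact: (convol_trunc2 n).1.
- by move=> n m; exact: (Rintegrable2B (convol_trunc2 n) (convol_trunc2 m)).2.
- exact: convol_trunc_cauchy.
exists h; split => //.
have := Rintegrable2B (convol_trunc2 0%N) (h2 0%N); congr (Rintegrable2 mu _).
by apply/funext => x; ring.
Qed.

Lemma convol_poisson_cpoisson s a x : 0 < s -> 0 < a -> s != a ->
  Rintegrable mu (fun y => poisson s (x - y) * convol (cpoisson a) g y) /\
  convol (poisson s) (convol (cpoisson a) g) x = pi * convol (cpoisson (s + a)) g x.
Proof.
move=> s0 a0 sa; have mg := g2.1.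
(* A bound, uniform in [y], for the integral of [|cpoisson a (y - z) * g z|] over [z]: reflected
   translates of the kernel share one L^2 norm. *)
pose C := \int[mu]_z (cpoisson a z ^+ 2) + \int[mu]_z (g z ^+ 2).
have qa2 := Rintegrable2_cpoisson a0.
have jF : Rintegrable (mu \x mu)%E (fun t : R * R =>
    poisson s (x - t.1) * (cpoisson a (t.1 - t.2) * g t.2)).
  apply: (@Rintegrable_prod1 _ _ _ _ R mu mu _ (fun y => poisson s (x - y) * C)) => /=.
  - apply: measurable_funM.
      by apply: measurable_fun_comp_sub => //; exact: measurable_poisson.
    apply: measurable_funM; last exact: (measurable_snd_comp mg).
    by apply: measurable_fun_comp_sub => //; exact: measurable_cpoisson.
  - by move=> y; apply: RintegrableZl; exact: Rintegrable_convol.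
  - move=> y; have q2 := Rintegrable2_reflect y qa2.
    under eq_fun do rewrite normrM (ger0_norm (poisson_ge0 _ s0)).
    rewrite Rintegral_scale; last exact/Rintegrable_norm/Rintegrable_convol.
    rewrite ler_wpM2l ?poisson_ge0//.
    apply: (le_trans (Rintegral_mul_le ltr01 q2 g2)).
    by rewrite invr1 !mul1r /C (Rintegral_reflect y qa2.2).
  - by apply: RintegrableZr; exact: (Rintegrable_reflect x (Rintegrable_poisson s0)).
have jpq : forall v, Rintegrable mu (fun w => poisson s (v - w) * cpoisson a w).
  by move=> v; apply: Rintegrable_convol => //; exact: Rintegrable2_poisson.
have FE y : \int[mu]_z (poisson s (x - y) * (cpoisson a (y - z) * g z)) =
    poisson s (x - y) * convol (cpoisson a) g y.
  by rewrite Rintegral_scale//; exact: Rintegrable_convol.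
split; first by have := Rintegrable_fubini1 jF; apply: eq_Rintegrable => y; rewrite -FE.
rewrite /convol; under eqT_Rintegral do rewrite -FE.
rewrite (Rfubini jF)/= -Rintegral_scale; last first.
  by apply: Rintegrable_convol => //; apply: Rintegrable2_cpoisson; exact: addr_gt0.
apply: eqT_Rintegral => z.
rewrite mulrA -(poisson_cpoisson_convolution (x - z) s0 a0 sa).
rewrite -(Rintegral_shift z (jpq (x - z))) mulrC -Rintegral_scale; last first.
  exact: (Rintegrable_shift z (jpq (x - z))).
apply: eqT_Rintegral => y; rewrite (_ : x - z - (y - z) = x - y); last by ring.
by ring.
Qed.

(** The limit kernel is left free because it is [cpoisson s] in one use and 0 in the other. The
    lower bound on the scales gives the common majorant [s^-1 * poisson s] for the squared
    kernels. *)
Lemma cvg_convol_cpoisson (t_ : nat -> R) (k : R -> R) s x : 0 < s ->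
  (forall n, s <= t_ n) -> (forall z, cpoisson (t_ n) z @[n --> \oo] --> k z) ->
  convol (cpoisson (t_ n)) g x @[n --> \oo] --> convol k g x.
Proof.
move=> s0 st ck; have mg := g2.1.
have t0 n : 0 < t_ n by exact: lt_le_trans (st n).
have [||||_ //] := @dominated_Rintegral _ _ R mu
  (fun n y => cpoisson (t_ n) (x - y) * g y) (fun y => k (x - y) * g y)
  (fun y => s^-1 * poisson s (x - y) + g y ^+ 2).
- by move=> n; apply: Rintegrable_measurable; apply: Rintegrable_convol => //;
    exact: Rintegrable2_cpoisson.
- by move=> y; apply: cvgM; [exact: ck|exact: cvg_cst].
- move=> n y; have q2 : cpoisson (t_ n) (x - y) ^+ 2 <= s^-1 * poisson s (x - y).
    apply: (le_trans (cpoisson_sqr_le _ (t0 n))).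
    rewrite /poisson !mulKf ?gt_eqF// lef_pV2 ?posrE ?poisson_den_gt0// lerD2l.
    by rewrite ler_pXn2r// ?nnegrE ltW.
  have := sqr_ge0 (cpoisson (t_ n) (x - y) - g y).
  have := sqr_ge0 (cpoisson (t_ n) (x - y) + g y).
  rewrite ler_norml; nra.
- apply: RintegrableD; last exact: g2.2.
  by apply: RintegrableZl; exact: (Rintegrable_reflect x (Rintegrable_poisson s0)).
Qed.

(** For fixed [x], pairing with the L^2 function [poisson s (x - y)] is continuous in mean square.
    Along the sequence it produces the scales [s + n.+1%:R^-1] and [s + n.+1%:R], and the term of
    the second vanishes in the limit. *)
Lemma convol_poisson_limit h s x : Rintegrable2 mu h ->
  (forall n, Rintegrable2 mu (fun x => convol (trunc_kernel n) g x - h x)) ->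
  \int[mu]_x ((convol (trunc_kernel n) g x - h x) ^+ 2) @[n --> \oo] --> 0 ->
  0 < s -> convol (poisson s) h x = pi * convol (cpoisson s) g x.
Proof.
move=> h2 uh2 cuh s0.
have p2 : Rintegrable2 mu (fun y => poisson s (x - y)).
  exact: (Rintegrable2_reflect x (Rintegrable2_poisson s0)).
have lim1 : convol (poisson s) (convol (trunc_kernel n) g) x @[n --> \oo] -->
    convol (poisson s) h x.
  apply/cvgrPdist_le => e e0.
  have /cvgrPdist_le /(_ _ e0)[N _ NP] := cvg_Rintegral_mul p2 uh2 cuh.
  exists N => // n Nn /=; have := NP n Nn; rewrite /= sub0r normrN ger0_norm; last first.
    by apply: Rintegral_ge0 => y _; exact: normr_ge0.
  apply: le_trans; rewrite distrC /convol -Rintegral_sub.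
  - under eqT_Rintegral do rewrite -mulrBr.
    exact/Rintegral_norm/(Rintegrable2_mul p2 (uh2 n)).
  - exact: (Rintegrable2_mul p2 (convol_trunc2 n)).
  - exact: (Rintegrable2_mul p2 h2).
have lim2 : pi * (convol (cpoisson (s + n.+1%:R^-1)) g x -
    convol (cpoisson (s + n.+1%:R)) g x) @[n --> \oo] --> pi * convol (cpoisson s) g x.
  apply: cvgM; first exact: cvg_cst.
  rewrite -[X in _ --> X]subr0; apply: cvgB.
    apply: (@cvg_convol_cpoisson _ _ s) => // [n|z].
      by rewrite lerDl invr_ge0.
    apply: cvgM; first exact: cvg_cst.
    apply: cvgV; first by rewrite gt_eqF// poisson_den_gt0.
    apply: cvgD; first exact: cvg_cst.
    rewrite [X in _ --> X](_ : _ = (s + 0) * (s + 0)); last by rewrite addr0 expr2.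
    under eq_fun do rewrite expr2.
    by apply: cvgM; apply: cvgD; (try exact: cvg_cst); exact: cvg_harmonic.
  rewrite (_ : 0 = convol (fun=> 0) g x); last first.
    rewrite /convol /Rintegral (eq_integral (cst 0%E)) ?integral0// => y _.
    by rewrite mul0r.
  apply: (@cvg_convol_cpoisson _ _ s) => // [n|z]; first by rewrite lerDl.
  apply/norm_cvg0P; apply: (@squeeze_cvgr _ _ _ _ (cst 0) (fun n => `|z| * n.+1%:R^-1)).
  - near=> n; rewrite normr_ge0/=.
    have n0 : 0 < n.+1%:R :> R by [].
    have n1 : 1 <= n.+1%:R :> R by rewrite ler1n.
    have t0 : 0 < s + n.+1%:R by rewrite addr_gt0.
    have d0 := poisson_den_gt0 z t0.
    rewrite normrM ler_wpM2l// normfV gtr0_norm// lef_pV2 ?posrE//.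
    have := sqr_ge0 z; move: n.+1%:R n0 n1 {t0 d0} => m m0 m1; nra.
  - exact: cvg_cst.
  - rewrite -[X in _ --> X](mulr0 `|z|); apply: cvgM; first exact: cvg_cst.
    exact: cvg_harmonic.
suff lim3 : convol (poisson s) (convol (trunc_kernel n) g) x @[n --> \oo] -->
    pi * convol (cpoisson s) g x by exact: (cvg_unique _ lim1 lim3).
apply: cvg_trans lim2; apply: near_eq_cvg.
(* For large [n] both scales of the truncated kernel differ from [s], as [convol_poisson_cpoisson]
   requires. *)
have ns0 := nbhs_infty_gtr s; have ns1 := nbhs_infty_gtr s^-1.
near=> n.
have ns : s < n%:R by near: n; exact: ns0.
have nsV : s^-1 < n%:R by near: n; exact: ns1.
have a0 : 0 < n.+1%:R^-1 :> R by rewrite invr_gt0.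
have ga2 : Rintegrable2 mu (cpoisson n.+1%:R^-1) by exact: Rintegrable2_cpoisson.
have gb2 : Rintegrable2 mu (cpoisson n.+1%:R) by exact: Rintegrable2_cpoisson.
have b0 : 0 < n.+1%:R :> R by [].
have sa : s != n.+1%:R^-1.
  rewrite gt_eqF// -[ltRHS]invrK ltf_pV2 ?posrE ?invr_gt0//.
  by rewrite (lt_trans nsV)// ltr_nat.
have sb : s != n.+1%:R.
  by rewrite lt_eqF// (lt_trans ns)// ltr_nat.
have [ja Ea] := convol_poisson_cpoisson x s0 a0 sa.
have [jb Eb] := convol_poisson_cpoisson x s0 b0 sb.
rewrite mulrBr -Ea -Eb -Rintegral_sub//.
by apply: eqT_Rintegral => y; rewrite convol_trunc_kernelE mulrBr.
Unshelve. all: end_near. Qed.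

End conjugate_limit.
End hilbert_L2.

(** * Lebesgue points *)

Section approximate_identity.
Context (R : realType).
Local Notation mu := (@lebesgue_measure R).
Implicit Types (e r x y z : R) (D : R -> R).

(** On the shell [2 ^+ k * e <= |z| < 2 ^+ k.+1 * e] the kernel is at most [e / z ^+ 2], which
    explains the height with its factor 4. Radius times height decays like [2^-1 ^+ k], so bounds on
    ball averages can be summed. *)
Lemma poisson_dyadic e z (N : nat) : 0 < e -> `|z| < 2 ^+ N * e ->
  poisson e z <= \sum_(k < N.+1) (if `|z| < 2 ^+ k * e then 4 / (4 ^+ k * e) else 0).
Proof.
move=> e0; have d0 := poisson_den_gt0 z e0.
elim: N => [|N IH] zN.
  rewrite big_ord1 zN !expr0 mul1r /poisson ler_pdivlMr// mulrC mulrA ler_pdivrMr//.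
  have := sqr_ge0 z; have := sqr_ge0 e; nra.
rewrite big_ord_recr/=; have [zN'|zN'] := ltP `|z| (2 ^+ N * e).
  rewrite (le_trans (IH zN'))// lerDl; case: ifP => // _.
  by rewrite divr_ge0// mulr_ge0 ?exprn_ge0// ltW.
rewrite zN ler_wpDl//.
  by apply: sumr_ge0 => k _; case: ifP => // _; rewrite divr_ge0// mulr_ge0 ?exprn_ge0// ltW.
have p0 : 0 < 4 ^+ N.+1 * e by rewrite mulr_gt0// exprn_gt0.
rewrite /poisson ler_pdivlMr// mulrAC ler_pdivrMr//.
have : (2 ^+ N * e) ^+ 2 <= `|z| ^+ 2.
  by rewrite ler_pXn2r// nnegrE// mulr_ge0 ?exprn_ge0// ltW.
rewrite real_normK ?num_real// exprMn -exprM mulnC exprM (_ : 2 ^+ 2 = 4); last by ring.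
rewrite (exprS 4 N) => zN2; rewrite [leLHS](_ : _ = 4 * (4 ^+ N * e ^+ 2)); last by ring.
by have := sqr_ge0 e; lra.
Qed.

(** Reduces integrability against every scale to the scale 1. Away from 0 the next lemma improves
    the factor to one that vanishes with [e]. *)
Lemma poisson_le1 e z : 0 < e -> poisson e z <= (e + e^-1) * poisson 1 z.
Proof.
move=> e0; have d0 := poisson_den_gt0 z e0; have d1 := poisson_den_gt0 z (@ltr01 R).
rewrite /poisson mulrA mulr1 ler_pdivlMr// mulrAC ler_pdivrMr//.
have ee : e * e^-1 = 1 by rewrite mulfV// gt_eqF.
have : 0 <= e^-1 * z ^+ 2 by rewrite mulr_ge0 ?invr_ge0 ?sqr_ge0 ?ltW.
have : 0 <= e ^+ 3 by rewrite exprn_ge0 ?ltW.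
move=> e3 ez; rewrite [leRHS]
    (_ : _ = e * z ^+ 2 + e ^+ 3 + e^-1 * z ^+ 2 + (e * e^-1) * e); last by ring.
rewrite ee expr1n; lra.
Qed.

Lemma poisson_far e d z : 0 < e -> 0 < d -> d <= `|z| ->
  poisson e z <= e * (1 + d ^- 2) * poisson 1 z.
Proof.
move=> e0 d0 dz; have p0 := poisson_den_gt0 z e0; have p1 := poisson_den_gt0 z (@ltr01 R).
have dz2 : d ^+ 2 <= z ^+ 2.
  by rewrite -(real_normK (num_real z)) ler_pXn2r// nnegrE// ltW.
have dd : d ^- 2 * d ^+ 2 = 1 by rewrite mulVf// gt_eqF// exprn_gt0.
have dV : 0 <= d ^- 2 by rewrite invr_ge0 exprn_ge0// ltW.
rewrite /poisson !mulrA mulr1 ler_pdivlMr// mulrAC ler_pdivrMr// -!mulrA ler_pM2l//.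
have : d ^- 2 * d ^+ 2 <= d ^- 2 * z ^+ 2 by rewrite ler_wpM2l.
rewrite dd expr1n; have : 0 <= (1 + d ^- 2) * e ^+ 2 by rewrite mulr_ge0 ?sqr_ge0 ?addr_ge0.
lra.
Qed.

Section lebesgue_point.
Variables (D : R -> R).
Hypothesis mD : measurable_fun (setT : set R) D.
(** This weighted condition covers both uses: the integrable [f] and the square-integrable limit
    [h]. *)
Hypothesis jD : forall x, Rintegrable mu (fun y => poisson 1 (x - y) * `|D y|).

Let W x y := `|D y - D x|.

Let W0 x y : 0 <= W x y. Proof. exact: normr_ge0. Qed.

Let mW x : measurable_fun (setT : set R) (W x).
Proof.
by apply: measurableT_comp => //; apply: measurable_funB.
Qed.

Let mp e x : 0 < e -> measurable_fun (setT : set R) (fun y => poisson e (x - y)).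
Proof.
by move=> e0; apply: measurable_fun_comp_sub => //; exact: measurable_poisson.
Qed.

Let jW1 x : Rintegrable mu (fun y => poisson 1 (x - y) * W x y).
Proof.
have := RintegrableD (jD x)
  (RintegrableZr `|D x| (Rintegrable_reflect x (Rintegrable_poisson (@ltr01 R)))).
move=> j; apply: Rintegrable_le j.
    by apply: measurable_funM; [exact: (@mp 1 x ltr01)|exact: mW].
move=> y; have p1 := poisson_ge0 (x - y) (@ltr01 R).
by rewrite (ger0_norm (mulr_ge0 p1 (W0 x y))) -mulrDr ler_wpM2l// /W ler_normB.
Qed.

Lemma Rintegrable_poisson_osc e x : 0 < e ->
  Rintegrable mu (fun y => poisson e (x - y) * `|D y - D x|).
Proof.
move=> e0; have := RintegrableZl (e + e^-1) (jW1 x).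
move=> j; apply: Rintegrable_le j; first by apply: measurable_funM; [exact: (@mp e x e0)|exact: mW].
move=> y; rewrite (ger0_norm (mulr_ge0 (poisson_ge0 _ e0) (W0 x y))) mulrA.
by rewrite ler_wpM2r//; exact: poisson_le1.
Qed.

Let mball x r : measurable (ball x r : set (measurableTypeR R)).
Proof. exact: measurable_ball. Qed.

Let jWball x r : Rintegrable mu (W x \_ (ball x r)).
Proof.
have := RintegrableZl (r ^+ 2 + 1) (jW1 x) => j; apply: Rintegrable_le j.
  by apply/(measurable_restrictT _ (mball x r)); exact: (measurable_funTS (mW x)).
move=> y; have p1 := poisson_den_gt0 (x - y) (@ltr01 R).
rewrite patchE; case: ifPn => [|_]; last first.
  rewrite normr0.
  exact: (mulr_ge0 (addr_ge0 (sqr_ge0 r) ler01) (mulr_ge0 (poisson_ge0 _ ltr01) (W0 x y))).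
rewrite inE -ball_normE /= => xyr; rewrite ger0_norm// mulrA.
rewrite -[leLHS]mul1r ler_wpM2r// /poisson mulrA mulr1 ler_pdivlMr// mul1r expr1n.
rewrite lerD2r -(real_normK (num_real (x - y))) ler_pXn2r ?nnegrE//; first exact: ltW.
by rewrite (le_trans (normr_ge0 _) (ltW xyr)).
Qed.

Lemma poisson_osc_small x e0 : lebesgue_pt D x -> 0 < e0 ->
  exists2 d, 0 < d & forall e, 0 < e -> e < d ->
    \int[mu]_y (poisson e (x - y) * `|D y - D x|) <= e0.
Proof.
(* The dyadic pieces add up to at most [8 * c * (1 + 1/2 + 1/4 + ...) = 16 * c], which is
   [e0 / 2]. *)
move=> Dx e00; pose c := e0 / 32.
have c0 : 0 < c by rewrite divr_gt0.
have [d d0 dP] : exists2 d, 0 < d & forall r, 0 < r -> r <= d ->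
    \int[mu]_y (W x \_ (ball x r)) y <= 2 * r * c.
  have /fine_cvgP[fin0 /cvgrPdist_lt /(_ _ c0) lt0] := Dx.
  have [d /= d0 dP] : \forall r \near 0^'+, davg D x r \is a fin_num /\
      `|0 - fine (davg D x r)| < c.
    by apply: filterS2 fin0 lt0 => r; split.
  exists (d / 2); first by rewrite divr_gt0.
  move=> r r0 rd; have [] := dP r _ r0.
    by rewrite /= sub0r normrN gtr0_norm//; lra.
  have -> : davg D x r = ((r *+ 2)^-1 * \int[mu]_y (W x \_ (ball x r)) y)%:E.
    rewrite /davg /iavg lebesgue_measure_ball ?ltW// inver mulrn_eq0/= gt_eqF//.
    rewrite EFinM -Rintegral_EFin//; congr (_ * _)%E.
    rewrite [LHS]integral_mkcond; apply: eq_integral => y _.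
    by rewrite /patch; case: ifPn.
  move=> _ /=; rewrite sub0r normrN ger0_norm; last first.
    apply: mulr_ge0; first by rewrite invr_ge0 mulrn_wge0// ltW.
    by apply: Rintegral_ge0 => y _; rewrite patchE; case: ifPn.
  by rewrite ltr_pdivrMl ?mulrn_wgt0// (_ : r *+ 2 = 2 * r) ?mulr_natl// => /ltW.
pose K := \int[mu]_y (poisson 1 (x - y) * W x y).
have K0 : 0 <= K.
  by apply: Rintegral_ge0 => y _; exact: (mulr_ge0 (poisson_ge0 _ ltr01) (W0 x y)).
pose C := (1 + d ^- 2) * K.
have C0 : 0 <= C by rewrite mulr_ge0// addr_ge0// invr_ge0 exprn_ge0// ltW.
(* The far part is at most [e * C], hence at most [e0 / 2] in this range; the added 1 allows for
   [C = 0]. *)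
exists (e0 / (2 * (C + 1))).
  by rewrite divr_gt0// mulr_gt0// ltr_wpDl.
move=> e ep ed.
have [N dN] : exists N : nat, d <= 2 ^+ N * e.
  exists (Num.truncn (d / e)).+1; rewrite -ler_pdivrMr//.
  rewrite (le_trans (ltW (truncnS_gt _)))// -natrX ler_nat ltnW// ltn_expl//.
(* Capping the radius at [d] keeps every ball in the range where averages are small, and loses no
   point with [|x - y| < d]. *)
pose f (k : nat) y := (4 / (4 ^+ k * e)) * (W x \_ (ball x (Num.min d (2 ^+ k * e)))) y.
have jf k : Rintegrable mu (f k) by exact: RintegrableZl.
pose S y := \sum_(k < N.+1) f k y.
have [jS IS] : Rintegrable mu S /\ \int[mu]_y S y = \sum_(k < N.+1) \int[mu]_y f k y.
  exact: Rintegrable_bigsum.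
have fk k : \int[mu]_y f k y <= geometric (8 * c) 2^-1 k.
  have k0 : 0 < 2 ^+ k :> R by rewrite exprn_gt0.
  have ke : 0 < 4 ^+ k * e by rewrite mulr_gt0// exprn_gt0.
  have m0 : 0 < Num.min d (2 ^+ k * e) by rewrite lt_min d0/= mulr_gt0.
  rewrite Rintegral_scale//=.
  have md : Num.min d (2 ^+ k * e) <= d by rewrite ge_min lexx.
  have h : \int[mu]_y (W x \_ (ball x (Num.min d (2 ^+ k * e)))) y <= 2 * (2 ^+ k * e) * c.
    apply: (le_trans (dP _ m0 md)).
    by rewrite ler_wpM2r ?(ltW c0)// ler_wpM2l// ge_min lexx orbT.
  apply: (@le_trans _ _ (4 / (4 ^+ k * e) * (2 * (2 ^+ k * e) * c))).
    by rewrite ler_wpM2l// divr_ge0// ltW.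
  rewrite (_ : 4 ^+ k = 2 ^+ k * 2 ^+ k); last by rewrite -exprMn; congr (_ ^+ _); ring.
  rewrite exprVn le_eqVlt; apply/orP; left; apply/eqP.
  by move: (2 ^+ k) k0 => a a0; field; rewrite !gt_eqF.
have {}IS : \int[mu]_y S y <= e0 / 2.
  rewrite IS; apply: (@le_trans _ _ (series (geometric (8 * c) 2^-1) N.+1)).
    by rewrite /series/= big_mkord; apply: ler_sum => k _; exact: fk.
  have := @geometric_le_lim R N.+1 (8 * c) 2^-1.
  rewrite mulr_ge0 ?(ltW c0)// invr_gt0 ger0_norm ?invr_ge0// invf_lt1//.
  rewrite ltr1n ltr0n => /(_ isT isT isT)/le_trans; apply.
  by rewrite le_eqVlt; apply/orP; left; apply/eqP; rewrite /c; field.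
have jfar := RintegrableZl (e * (1 + d ^- 2)) (jW1 x).
apply: (@le_trans _ _ (\int[mu]_y (S y + e * (1 + d ^- 2) * (poisson 1 (x - y) * W x y)))).
  apply: Rintegral_le; [exact: Rintegrable_poisson_osc|exact: RintegrableD|].
  move=> y; rewrite -/(W x y).
  have fk0 k : 0 <= f k y.
    rewrite mulr_ge0 ?divr_ge0 ?mulr_ge0 ?exprn_ge0 ?(ltW ep)//.
    by rewrite patchE; case: ifP.
  have far0 : 0 <= e * (1 + d ^- 2).
    by rewrite mulr_ge0 ?addr_ge0 ?invr_ge0 ?exprn_ge0 ?ltW.
  have [xyd|xyd] := ltP `|x - y| d; last first.
    rewrite ler_wpDl ?sumr_ge0// mulrA ler_wpM2r//; exact: poisson_far.
  rewrite ler_wpDr//; first exact: (mulr_ge0 far0 (mulr_ge0 (poisson_ge0 _ ltr01) (W0 x y))).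
  apply: (le_trans (ler_wpM2r _ (poisson_dyadic ep (lt_le_trans xyd dN)))) => //.
  rewrite mulr_suml; apply: ler_sum => k _; case: ifP => [zk|_]; last by rewrite mul0r.
  by rewrite /f patchE mem_set// -ball_normE /= lt_min xyd.
rewrite Rintegral_add// Rintegral_scale// -/K -mulrA -/C [leRHS]splitr lerD//.
move: ed; rewrite ltr_pdivlMr; last by rewrite mulr_gt0// ltr_wpDl.
rewrite ler_pdivlMr//; nra.
Qed.

End lebesgue_point.
End approximate_identity.

(** * Principal values *)

Section hilbert_kernel.
Context (R : realType).
Local Notation mu := (@lebesgue_measure R).
Implicit Types (e r x y z : R) (D f : R -> R).

(** On a compact set [poisson 1] is bounded below, so weighted integrability gives the local
    integrability that Lebesgue differentiation asks for. *)
Lemma ae_lebesgue_pt D : measurable_fun (setT : set R) D ->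
  Rintegrable mu (fun y => poisson 1 y * `|D y|) ->
  {ae mu, forall x, lebesgue_pt D x}.
Proof.
move=> mD jD; apply: lebesgue_differentiation; split => //; first exact: openT.
move=> K _ cK; have mK : measurable (K : set (measurableTypeR R)) by exact: compact_measurable.
have [M [_ /(_ (M + 1))]] := compact_bounded cK.
rewrite ltrDl ltr01 => /(_ isT) KM.
pose C := (M + 1) ^+ 2 + 1.
have jK : Rintegrable mu ((fun y => `|D y|) \_ K).
  apply: Rintegrable_le (RintegrableZl C jD).
    by apply/(measurable_restrictT _ mK)/measurable_funTS; exact: measurableT_comp.
  move=> y; have p1 := poisson_den_gt0 y (@ltr01 R); rewrite patchE.
  have C0 : 0 <= C by rewrite addr_ge0// sqr_ge0.
  case: ifPn => [|_]; last first.
    by rewrite normr0; exact: (mulr_ge0 C0 (mulr_ge0 (poisson_ge0 _ ltr01) (normr_ge0 _))).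
  rewrite inE normr_id => /KM yM; rewrite mulrA -[leLHS]mul1r ler_wpM2r//.
  rewrite /poisson mulrA mulr1 ler_pdivlMr// mul1r expr1n lerD2r.
  by rewrite -(real_normK (num_real y)) ler_pXn2r ?nnegrE//; exact: le_trans yM.
have -> : (\int[mu]_(x in K) `|D x|%:E =
    (\int[mu]_y (((fun y => `|D y|) \_ K) y)%R)%R%:E)%E.
  rewrite -Rintegral_EFin//.
  rewrite [LHS]integral_mkcond; congr (integral _ setT _).
  by apply/funext => y; rewrite /patch; case: ifPn.
exact: ltry.
Qed.

Lemma cvg_convol_poisson D x : measurable_fun (setT : set R) D ->
  (forall x, Rintegrable mu (fun y => poisson 1 (x - y) * `|D y|)) ->
  lebesgue_pt D x -> convol (poisson e) D x @[e --> 0^'+] --> pi * D x.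
Proof.
move=> mD jD Dx; apply/cvgrPdist_le => e0 e00.
have [d d0 dP] := poisson_osc_small mD jD Dx e00.
near=> e.
have ep : 0 < e by near: e; exact: nbhs_right_gt.
have ed : e < d by near: e; exact: nbhs_right_lt.
have josc := Rintegrable_poisson_osc mD jD x ep.
have jp := Rintegrable_reflect x (Rintegrable_poisson ep).
have jd : Rintegrable mu (fun y => poisson e (x - y) * (D y - D x)).
  apply: Rintegrable_le josc.
    apply: measurable_funM; first exact: Rintegrable_measurable jp.
    exact: measurable_funB.
  by move=> y; rewrite normrM (ger0_norm (poisson_ge0 _ ep)).
have -> : pi * D x - convol (poisson e) D x =
    - \int[mu]_y (poisson e (x - y) * (D y - D x)).
  have -> : convol (poisson e) D x =
      \int[mu]_y (poisson e (x - y) * (D y - D x) + D x * poisson e (x - y)).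
    by apply: eqT_Rintegral => y; ring.
  rewrite Rintegral_add//; last exact: RintegrableZl.
  rewrite Rintegral_scale// (Rintegral_reflect x (Rintegrable_poisson ep)).
  by rewrite Rintegral_poisson//; ring.
rewrite normrN (le_trans (Rintegral_norm jd))// (le_trans _ (dP e ep ed))//.
rewrite le_eqVlt; apply/orP; left; apply/eqP; apply: eqT_Rintegral => y.
by rewrite normrM (ger0_norm (poisson_ge0 _ ep)).
Unshelve. all: end_near. Qed.

Lemma cvg_trunc_kernel z : trunc_kernel n z @[n --> \oo] --> z^-1.
Proof.
(* At 0 every kernel vanishes and so does [0^-1], so convergence holds at every point and the
   diagonal needs no separate treatment. *)
have [->|z0] := eqVneq z 0.
  rewrite invr0; under eq_fun do rewrite /trunc_kernel /cpoisson !mul0r subr0.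
  exact: cvg_cst.
rewrite -[X in _ --> X]subr0; apply: cvgB.
  rewrite [X in _ --> X](_ : _ = z / (z ^+ 2 + 0 * 0)); last by field.
  apply: cvgM; first exact: cvg_cst.
  apply: cvgV; first by rewrite mul0r addr0 expf_neq0.
  apply: cvgD; first exact: cvg_cst.
  under eq_fun do rewrite expr2.
  by apply: cvgM; exact: cvg_harmonic.
apply/norm_cvg0P; apply: (@squeeze_cvgr _ _ _ _ (cst 0) (fun n => `|z| * n.+1%:R^-1)).
- apply: nearW => n; rewrite normr_ge0/=.
  have n1 : 1 <= n.+1%:R :> R by rewrite ler1n.
  have n0 : 0 < n.+1%:R :> R by [].
  have d0 := poisson_den_gt0 z n0.
  rewrite normrM ler_wpM2l// normfV gtr0_norm// lef_pV2 ?posrE//.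
  by have := sqr_ge0 z; move: n.+1%:R n0 n1 {d0} => m m0 m1; nra.
- exact: cvg_cst.
- rewrite -[X in _ --> X](mulr0 `|z|); apply: cvgM; first exact: cvg_cst.
  exact: cvg_harmonic.
Qed.

Lemma measurable_trunc_kernel n : measurable_fun (setT : set R) (trunc_kernel n).
Proof. exact: (Rintegrable_measurable (Rintegrable_trunc_kernel R n)). Qed.

Lemma measurable_invr : measurable_fun (setT : set R) (fun z => z^-1).
Proof.
apply: (@measurable_fun_cvg _ _ R setT (@trunc_kernel R)).
  exact: measurable_trunc_kernel.
by move=> z _; exact: cvg_trunc_kernel.
Qed.

Lemma cpoisson_le_inv a z : 0 < a -> `|cpoisson a z| <= `|z|^-1.
Proof.
move=> a0; have d0 := poisson_den_gt0 z a0.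
have [->|z0] := eqVneq z 0; first by rewrite /cpoisson mul0r normr0 invr0.
rewrite normrM normfV (gtr0_norm d0) ler_pdivrMr// ler_pdivlMl ?normr_gt0//.
by rewrite -normrM -expr2 ger0_norm ?sqr_ge0// lerDl sqr_ge0.
Qed.

(** Both values lie between 0 and [z^-1], hence no factor 2. *)
Lemma cpoissonB_le_inv a b z : 0 < a -> 0 < b -> `|cpoisson a z - cpoisson b z| <= `|z|^-1.
Proof.
move=> a0 b0.
have := cpoisson_le_inv z a0; have := cpoisson_le_inv z b0.
rewrite /cpoisson; set A := z ^+ 2 + a ^+ 2; set B := z ^+ 2 + b ^+ 2.
have A0 : 0 <= A^-1 by rewrite invr_ge0 ltW// poisson_den_gt0.
have B0 : 0 <= B^-1 by rewrite invr_ge0 ltW// poisson_den_gt0.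
have [z0|z0] := leP 0 z.
  have zA : 0 <= z / A by exact: mulr_ge0.
  have zB : 0 <= z / B by exact: mulr_ge0.
  rewrite (ger0_norm zA) (ger0_norm zB) ler_norml; lra.
have zA : z / A <= 0 by rewrite mulr_le0_ge0// ltW.
have zB : z / B <= 0 by rewrite mulr_le0_ge0// ltW.
rewrite (ler0_norm zA) (ler0_norm zB) ler_norml; lra.
Qed.

Lemma trunc_kernel_le_inv n z : `|trunc_kernel n z| <= `|z|^-1.
Proof. by apply: cpoissonB_le_inv; rewrite ?invr_gt0. Qed.

Definition cut_kernel e z : R := if e < `|z| then z^-1 else 0.

Lemma measurable_cut_kernel e : measurable_fun (setT : set R) (cut_kernel e).
Proof.
apply: measurable_fun_ifT; [|exact: measurable_invr|exact: measurable_cst].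
by apply: measurable_fun_ltr => //; exact: measurable_cst.
Qed.

Lemma cut_kernelN e z : cut_kernel e (- z) = - cut_kernel e z.
Proof. by rewrite /cut_kernel normrN invrN; case: ifP => //; rewrite oppr0. Qed.

Lemma cut_kernel_le e z : 0 < e -> `|cut_kernel e z| <= e^-1.
Proof.
move=> e0; rewrite /cut_kernel; case: ifPn => [ez|_].
  by rewrite normfV lef_pV2 ?posrE//; [exact: ltW|exact: lt_trans ez].
by rewrite normr0 invr_ge0 ltW.
Qed.

Lemma cut_kernel_cpoisson_le e z : 0 < e -> `|cut_kernel e z - cpoisson e z| <= poisson e z.
Proof.
move=> e0; have d0 := poisson_den_gt0 z e0.
rewrite /cut_kernel; case: ifPn => [ez|]; last first.
  rewrite -leNgt => ze; rewrite sub0r normrN /cpoisson /poisson.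
  by rewrite normrM normfV (gtr0_norm d0) ler_wpM2r// invr_ge0 ltW.
have z0 : z != 0 by rewrite -normr_gt0 (lt_trans e0).
have -> : z^-1 - cpoisson e z = e ^+ 2 / (z * (z ^+ 2 + e ^+ 2)).
  by rewrite /cpoisson; field; rewrite z0 gt_eqF.
rewrite normrM normfV (normrM z) (gtr0_norm d0) (ger0_norm (sqr_ge0 _)) /poisson.
rewrite invfM mulrA ler_wpM2r ?invr_ge0 ?(ltW d0)//.
by rewrite ler_pdivrMr ?normr_gt0// expr2 ler_pM2l// ltW.
Qed.

Section integrable_function.
Variable f : R -> R.
Hypothesis jf : Rintegrable mu f.

Let mf := Rintegrable_measurable jf.

Lemma Rintegrable_convol_bounded (k : R -> R) M x : measurable_fun (setT : set R) k ->
  (forall z, `|k z| <= M) -> Rintegrable mu (fun y => k (x - y) * f y).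
Proof.
move=> mk kM; apply: Rintegrable_le (RintegrableZl M (Rintegrable_norm jf)).
  by apply: measurable_funM => //; apply: measurable_fun_comp_sub.
by move=> y; rewrite normrM ler_wpM2r.
Qed.

Lemma Rintegrable_convol_cut e x : 0 < e -> Rintegrable mu (fun y => cut_kernel e (x - y) * f y).
Proof.
move=> e0; apply: (@Rintegrable_convol_bounded _ e^-1); first exact: measurable_cut_kernel.
by move=> z; exact: cut_kernel_le.
Qed.

Lemma Rintegrable_convol_cpoisson e x : 0 < e -> Rintegrable mu (fun y => cpoisson e (x - y) * f y).
Proof.
move=> e0; apply: (@Rintegrable_convol_bounded _ e^-1); first exact: measurable_cpoisson.
move=> z; rewrite -(@ler_pXn2r _ 2)// ?nnegrE ?invr_ge0 ?(ltW e0)//.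
rewrite real_normK ?num_real// (le_trans (cpoisson_sqr_le _ e0))// [leRHS]expr2.
rewrite ler_wpM2l ?invr_ge0 ?(ltW e0)// /poisson.
have d0 := poisson_den_gt0 z e0.
rewrite ler_pdivrMr// ler_pdivlMl// -expr2 lerDr sqr_ge0//.
Qed.

Lemma Rintegrable_poisson_mul x : Rintegrable mu (fun y => poisson 1 (x - y) * `|f y|).
Proof.
have mp := Rintegrable_measurable (Rintegrable_reflect x (Rintegrable_poisson (@ltr01 R))).
apply: Rintegrable_le (Rintegrable_norm jf).
  by apply: measurable_funM => //; exact: measurableT_comp.
move=> y; rewrite normrM normr_id -[leRHS]mul1r ler_wpM2r//.
rewrite (ger0_norm (poisson_ge0 _ ltr01)) /poisson ler_pdivrMr ?poisson_den_gt0// mul1r expr1n.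
by rewrite lerDr sqr_ge0.
Qed.

Lemma pv_truncE e x :
  \int[mu]_(y in [set y | e < `|x - y|]) (f y / (x - y)) = convol (cut_kernel e) f x.
Proof.
rewrite Rintegral_mkcond; apply: eqT_Rintegral => y.
rewrite patchE /cut_kernel.
have -> : (y \in [set y : R | e < `|x - y|]) = (e < `|x - y|).
  by apply/idP/idP; rewrite inE.
by case: ifP => _; rewrite ?mul0r// mulrC.
Qed.

Lemma cvg_cut_cpoisson x : lebesgue_pt f x ->
  convol (cut_kernel e) f x - convol (cpoisson e) f x @[e --> 0^'+] --> 0.
Proof.
move=> fx; apply/cvgrPdist_le => e0 e00.
have [d d0 dP] := poisson_osc_small mf Rintegrable_poisson_mul fx e00.
near=> e.
have ep : 0 < e by near: e; exact: nbhs_right_gt.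
have ed : e < d by near: e; exact: nbhs_right_lt.
rewrite sub0r normrN.
pose m z := cut_kernel e z - cpoisson e z.
have mm : measurable_fun (setT : set R) m.
  by apply: measurable_funB; [exact: measurable_cut_kernel|exact: measurable_cpoisson].
have jm : Rintegrable mu m.
  by apply: Rintegrable_le (Rintegrable_poisson ep) => // z; exact: cut_kernel_cpoisson_le.
(* Since [m] is odd, [f y] may be replaced by [f y - f x] in the convolution, and that is what a
   Lebesgue point controls. *)
have im0 : \int[mu]_z m z = 0.
  have : \int[mu]_z m z = - \int[mu]_z m z.
    rewrite -[in LHS](Rintegral_reflect0 jm) -Rintegral_opp//.
    by apply: eqT_Rintegral => z; rewrite /m cut_kernelN cpoissonN opprB opprK addrC.
  by lra.
have josc := Rintegrable_poisson_osc mf Rintegrable_poisson_mul x ep.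
have le_osc y : `|m (x - y) * (f y - f x)| <= poisson e (x - y) * `|f y - f x|.
  by rewrite normrM ler_wpM2r//; exact: cut_kernel_cpoisson_le.
have jd : Rintegrable mu (fun y => m (x - y) * (f y - f x)).
  apply: (@Rintegrable_le _ _ _ mu _ _ _ le_osc josc).
  by apply: measurable_funM; [exact: measurable_fun_comp_sub|exact: measurable_funB].
have -> : convol (cut_kernel e) f x - convol (cpoisson e) f x =
    \int[mu]_y (m (x - y) * (f y - f x)).
  rewrite /convol -Rintegral_sub;
    [|exact: Rintegrable_convol_cut|exact: Rintegrable_convol_cpoisson].
  transitivity (\int[mu]_y (m (x - y) * (f y - f x) + f x * m (x - y))).
    by apply: eqT_Rintegral => y; rewrite /m; ring.
  rewrite Rintegral_add//; last exact/RintegrableZl/(Rintegrable_reflect x jm).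
  rewrite Rintegral_scale; last exact: (Rintegrable_reflect x jm).
  by rewrite (Rintegral_reflect x jm) im0 mulr0 addr0.
rewrite (le_trans (Rintegral_norm jd))// (le_trans _ (dP e ep ed))//.
by apply: Rintegral_le => //; exact: Rintegrable_norm.
Unshelve. all: end_near. Qed.

End integrable_function.
End hilbert_kernel.

(** * Borel measurability of the Hilbert transform *)

Section measurable_hilbert.
Context (R : realType).
Local Notation mu := (@lebesgue_measure R).
Variable f : R -> R.
Hypothesis jf : Rintegrable mu f.

Let mf := Rintegrable_measurable jf.

Let T (e x : R) := convol (cut_kernel e) f x.

Let mT e : measurable_fun (setT : set R) (T e).
Proof. by apply: measurable_convol => //; exact: measurable_cut_kernel. Qed.

(** The cut-off inequality is strict, so points with [|x - y| = e] are removed at [e] and at every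
    larger radius; from the left, continuity could fail. *)
Let cvg_T_right e x : 0 < e -> T r x @[r --> e^'+] --> T e x.
Proof.
move=> e0; apply/cvg_at_rightP => u [eu ue].
have u0 n : 0 < u n by exact: lt_trans (eu n).
have [||||_ //] := @dominated_Rintegral _ _ R mu
  (fun n y => cut_kernel (u n) (x - y) * f y) (fun y => cut_kernel e (x - y) * f y)
  (fun y => e^-1 * `|f y|).
- by move=> n; apply: Rintegrable_measurable; exact: Rintegrable_convol_cut.
- move=> y; apply: cvgM; last exact: cvg_cst.
  apply: cvg_near_cst; rewrite /cut_kernel; have [exy|xye] := ltP e `|x - y|.
    near=> n; suff -> : u n < `|x - y| by [].
    by near: n; exact: (cvgr_lt _ ue).
  by near=> n; rewrite ltNge (le_trans xye)// ltW.
- move=> n y; rewrite normrM ler_wpM2r// (le_trans (cut_kernel_le _ (u0 n)))//.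
  by rewrite lef_pV2 ?posrE// ltW.
- exact/RintegrableZl/Rintegrable_norm.
Unshelve. all: end_near. Qed.

(* Lebesgue measure is not complete on Borel sets, so the set where the principal value
   exists must be shown to be Borel; by right continuity in [e] the Cauchy criterion need
   only be tested on rational truncations. *)
Let C : set R := \bigcap_(m : nat) \bigcup_(n : nat) \bigcap_(r : rat) \bigcap_(s : rat)
  [set x : R | (0 < (ratr r : R) < n.+1%:R^-1) -> (0 < (ratr s : R) < n.+1%:R^-1) ->
           `|T (ratr r) x - T (ratr s) x| <= m.+1%:R^-1].

Let mC : measurable C.
Proof.
apply: bigcapT_measurable => m; apply: bigcupT_measurable => n.
have mI (F : rat -> set R) : (forall r, measurable (F r)) -> measurable (\bigcap_r F r).
  move=> mF; rewrite -[X in measurable X]setCK setC_bigcap; apply: measurableC.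
  by apply: bigcupT_measurable_rat => r; exact: measurableC.
apply: (mI) => r; apply: (mI) => s.
have [r0|r0] := boolP (0 < (ratr r : R) < n.+1%:R^-1); last first.
  by rewrite (_ : mkset _ = setT)//; apply/seteqP; split.
have [s0|s0] := boolP (0 < (ratr s : R) < n.+1%:R^-1); last first.
  by rewrite (_ : mkset _ = setT)//; apply/seteqP; split.
rewrite (_ : mkset _ = [set x | `|T (ratr r) x - T (ratr s) x| <= m.+1%:R^-1]); last first.
  by apply/seteqP; split => [x /(_ isT isT)|x h _ _].
rewrite -[X in measurable X]setTI.
apply: (measurable_fun_ler (f := fun x => `|T (ratr r) x - T (ratr s) x|)
  (g := fun=> m.+1%:R^-1)) => //.
by apply: measurableT_comp => //; exact: measurable_funB.
Qed.

Let CP x : C x <-> cvg (T e x @[e --> 0^'+]).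
Proof.
split=> [Cx|/cvg_ex[l /cvgrPdist_lt Tl] m _]; last first.
  have m0 : 0 < m.+1%:R^-1 / 2 :> R by rewrite divr_gt0.
  have [d /= d0 dP] := Tl _ m0.
  exists (Num.truncn d^-1) => // r _ s _ /= /andP[r0 rn] /andP[s0 sn].
  have nd : (Num.truncn d^-1).+1%:R^-1 < d.
    by rewrite -[ltRHS]invrK ltf_pV2 ?posrE ?invr_gt0//; exact: truncnS_gt.
  have hr : `|l - T (ratr r) x| < m.+1%:R^-1 / 2.
    by apply: dP => //=; rewrite sub0r normrN gtr0_norm// (lt_trans rn nd).
  have hs : `|l - T (ratr s) x| < m.+1%:R^-1 / 2.
    by apply: dP => //=; rewrite sub0r normrN gtr0_norm// (lt_trans sn nd).
  rewrite (_ : T (ratr r) x - T (ratr s) x = (l - T (ratr s) x) - (l - T (ratr r) x)); last by ring.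
  by rewrite (le_trans (ler_normB _ _))// [leRHS]splitr lerD// ltW.
apply: cauchy_cvg; apply: cauchy_exP => eps eps0.
have e20 : 0 < eps / 2 by rewrite divr_gt0.
have [n _ nP] := Cx (Num.truncn (eps / 2)^-1) I.
have ltm : (Num.truncn (eps / 2)^-1).+1%:R^-1 < eps / 2.
  by rewrite -[ltRHS]invrK ltf_pV2 ?posrE ?invr_gt0//; exact: truncnS_gt.
have n0 : 0 < n.+1%:R^-1 :> R by rewrite invr_gt0.
have /rat_in_itvoo[r0] := n0; rewrite in_itv/= => r0n.
exists (T (ratr r0) x).
suff : \forall e \near 0^'+, ball (T (ratr r0) x) eps (T e x) by [].
near=> e.
have ep : 0 < e by near: e; exact: nbhs_right_gt.
have en : e < n.+1%:R^-1 by near: e; exact: nbhs_right_lt.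
have /cvgrPdist_lt /(_ _ e20)[d /= d0 dP] := @cvg_T_right e x ep.
(* A rational just to the right of [e] replaces [e] at a cost below [eps / 2]. *)
have /rat_in_itvoo[s] : e < Num.min (e + d) n.+1%:R^-1 by rewrite lt_min en ltrDl d0.
rewrite in_itv/= lt_min => /andP[es /andP[sd sn]].
have hs : `|T e x - T (ratr s) x| < eps / 2.
  by apply: dP => //=; rewrite distrC gtr0_norm ?subr_gt0// ltrBlDl.
have hr : `|T (ratr r0) x - T (ratr s) x| <= (Num.truncn (eps / 2)^-1).+1%:R^-1.
  by apply: (nP r0 I s I) => //; rewrite sn andbT (lt_trans ep).
rewrite -ball_normE /=.
rewrite
    (_ : T (ratr r0) x - T e x =
      (T (ratr r0) x - T (ratr s) x) - (T e x - T (ratr s) x)); last by ring.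
rewrite (le_lt_trans (ler_normB _ _))// [ltRHS]splitr ltr_leD// ?ltW//.
by rewrite (le_lt_trans hr).
Unshelve. all: end_near. Qed.

Lemma hilbertE x (l : R) : T e x @[e --> 0^'+] --> l -> hilbert f x = pi^-1 * l.
Proof.
move=> Tl; rewrite /hilbert /pv_integral; congr (_ * _).
rewrite [X in lim (X @ _)](_ : _ = T ^~ x); last by apply/funext => e; exact: pv_truncE.
exact/cvg_lim.
Qed.

Lemma measurable_hilbert : measurable_fun (setT : set R) (hilbert f).
Proof.
pose L x := fine (limn_esup (fun n => (T n.+1%:R^-1 x)%:E)).
have mL : measurable_fun (setT : set R) L.
  apply: measurableT_comp => //.
  apply: (measurable_fun_limn_esup (f := fun n x => (T n.+1%:R^-1 x)%:E)) => n.
  exact/measurable_EFinP.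
(* Off [C] the limit does not exist and [lim] returns the constant [point], so both pieces are
   measurable. *)
have -> : hilbert f = (fun x => pi^-1 * (L x * \1_C x + (point : R) * \1_(~` C) x)).
  apply/funext => x; rewrite !indicE in_setC.
  have [Cx|Cx] := boolP (x \in C).
    rewrite mulr1 mulr0 addr0; move/set_mem/CP : Cx => /cvg_ex[l Tl].
    rewrite (hilbertE Tl); congr (_ * _).
    have Tn : T n.+1%:R^-1 x @[n --> \oo] --> l.
      move/cvg_at_rightP : Tl => /(_ (@harmonic R)); apply; split; last exact: cvg_harmonic.
      by move=> n; rewrite invr_gt0.
    rewrite /L; have /cvg_limn_einf_sup[_ ->] // : (T n.+1%:R^-1 x)%:E @[n --> \oo] --> l%:E.
    exact: cvg_comp Tn _.
  rewrite mulr0 add0r mulr1; congr (_ * _); rewrite /pv_integral.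
  rewrite [X in lim (X @ _)](_ : _ = T ^~ x); last by apply/funext => e; exact: pv_truncE.
  by apply: dvgP => cT; move/negP : Cx; apply; apply/mem_set/CP.
apply: measurable_funM => //; apply: measurable_funD; apply: measurable_funM => //.
exact: measurable_indic (measurableC mC).
Qed.

End measurable_hilbert.

(** * The commutator identity *)

Section commutator.
Context (R : realType).
Local Notation mu := (@lebesgue_measure R).
Local Notation mu2 := (sigma_finite_prod mu mu).

Lemma Rintegrable_swap (F : R * R -> R) : Rintegrable mu2 F ->
  Rintegrable mu2 (fun z : R * R => F (z.2, z.1)).
Proof.
move=> jF; have mF := Rintegrable_measurable jF.
have ms : measurable_fun setT (fun z : R * R => F (z.2, z.1)).
  exact: (measurableT_comp mF (measurable_fun_pair measurable_snd measurable_fst)).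
have mF' : measurable_fun setT (EFin \o F) by exact/measurable_EFinP.
have j := (@integrable21ltyP _ _ _ _ R mu mu (EFin \o F) mF').1 jF.
have ms' := (measurable_EFinP _ _).2 ms.
exact: ((@integrable12ltyP _ _ _ _ R mu mu (EFin \o (fun z : R * R => F (z.2, z.1))) ms').2 j).
Qed.

Variables (phi f : R -> R) (L : R).
Hypothesis phi_lip : forall x y, `|phi x - phi y| <= L * `|x - y|.
Hypothesis mphi : measurable_fun (setT : set R) phi.
Hypothesis jf : Rintegrable mu f.
Hypothesis jphi : Rintegrable mu (fun x => `|phi x| * f x ^+ 2).

Let mf := Rintegrable_measurable jf.
Let psi x := Num.sqrt `|phi x|.
(** A square root of [|phi|] carrying the sign of [phi]. At a zero of [phi] the convention
    [0^-1 = 0] makes it 0, so [gam x * psi x = phi x] holds everywhere. *)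
Let gam x := phi x / psi x.
Let g x := psi x * f x.
Let G x := gam x * f x.

Let gamE x : gam x * psi x = phi x.
Proof.
rewrite /gam; have [p0|p0] := eqVneq (psi x) 0; last by rewrite divfK.
rewrite p0 mulr0; apply/esym/eqP; rewrite -normr_le0.
by move/eqP : p0; rewrite sqrtr_eq0.
Qed.

Let psi2 x : psi x ^+ 2 = `|phi x|.
Proof. by rewrite sqr_sqrtr. Qed.

Let psi0 x : 0 <= psi x.
Proof. exact: sqrtr_ge0. Qed.

Let gam_norm x : `|gam x| = psi x.
Proof.
rewrite /gam normrM normfV (ger0_norm (psi0 x)) -psi2.
have [->|p0] := eqVneq (psi x) 0; first by rewrite invr0 mulr0.
by rewrite expr2 mulfK.
Qed.

(* This is what reduces the theorem to square-integrable functions: multiplying the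
   difference quotient of [psi], which is merely 1/2-Hoelder, by [gam] makes it bounded. *)
Let gam_lip x y : `|gam x * (psi x - psi y)| <= L * `|x - y|.
Proof.
rewrite normrM gam_norm; apply: le_trans (phi_lip x y).
apply: le_trans (ler_dist_dist _ _); rewrite -!psi2 subr_sqr normrM mulrC.
by rewrite ler_wpM2l// ger0_norm ?addr_ge0// lerDl.
Qed.

Let L0 : 0 <= L.
Proof. by have := phi_lip 1 0; rewrite subr0 normr1 mulr1; exact: le_trans. Qed.

Let mpsi : measurable_fun (setT : set R) psi.
Proof.
have ms : measurable_fun (setT : set R) (@Num.sqrt R).
  by apply: continuous_measurable_fun; exact: sqrt_continuous.
by apply: (measurableT_comp ms); exact: measurableT_comp.
Qed.

Let mgam : measurable_fun (setT : set R) gam.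
Proof.
by apply: measurable_funM => //; apply: measurableT_comp => //; exact: measurable_invr.
Qed.

Let g2 : Rintegrable2 mu g.
Proof.
split; first exact: measurable_funM.
by apply: eq_Rintegrable jphi => x; rewrite /g exprMn psi2.
Qed.

Let G2 : Rintegrable2 mu G.
Proof.
split; first exact: measurable_funM.
apply: eq_Rintegrable jphi => x; rewrite /G exprMn; congr (_ * _).
by rewrite -psi2 -gam_norm real_normK ?num_real.
Qed.

(** The commutator integral. The kernel is left free: truncated, conjugate Poisson and [z^-1] all
    satisfy [|k z| <= |z|^-1], which bounds the integrand by [L * |f y|]. *)
Let S (k : R -> R) x := \int[mu]_y (gam x * (psi x - psi y) * k (x - y) * f y).

Let S_bound (k : R -> R) x y : (forall z : R, `|k z| <= `|z|^-1) ->
  `|gam x * (psi x - psi y) * k (x - y) * f y| <= L * `|f y|.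
Proof.
move=> kV; rewrite normrM ler_wpM2r// normrM.
have [->|xy] := eqVneq x y; first by rewrite subrr mulr0 normr0 mul0r.
apply: (@le_trans _ _ (L * `|x - y| * `|x - y|^-1)).
  by apply: ler_pM => //; exact: gam_lip.
by rewrite mulfK// normr_eq0 subr_eq0.
Qed.

Let jLf : Rintegrable mu (fun y => L * `|f y|).
Proof. exact/RintegrableZl/Rintegrable_norm. Qed.

Let mS (k : R -> R) x : measurable_fun (setT : set R) k ->
  measurable_fun (setT : set R) (fun y => gam x * (psi x - psi y) * k (x - y) * f y).
Proof.
move=> mk; apply: measurable_funM => //; apply: measurable_funM.
  by apply: measurable_funM => //; apply: measurable_funB.
exact: measurable_fun_comp_sub.
Qed.

Let jS (k : R -> R) x : measurable_fun (setT : set R) k -> (forall z : R, `|k z| <= `|z|^-1) ->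
  Rintegrable mu (fun y => gam x * (psi x - psi y) * k (x - y) * f y).
Proof.
move=> mk kV; apply: Rintegrable_le jLf; first exact: mS.
by move=> y; exact: S_bound.
Qed.

Let cvg_S (k_ : nat -> R -> R) x : (forall n, measurable_fun (setT : set R) (k_ n)) ->
  (forall n z, `|k_ n z| <= `|z|^-1) -> (forall z, k_ n z @[n --> \oo] --> z^-1) ->
  S (k_ n) x @[n --> \oo] --> S (@GRing.inv R) x.
Proof.
move=> mk kV ck.
have [||||_ //] := @dominated_Rintegral _ _ R mu
  (fun n y => gam x * (psi x - psi y) * k_ n (x - y) * f y)
  (fun y => gam x * (psi x - psi y) * (x - y)^-1 * f y) (fun y => L * `|f y|).
- by move=> n; exact: mS.
- move=> y; apply: cvgM; last exact: cvg_cst.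
  by apply: cvgM; [exact: cvg_cst|exact: ck].
- by move=> n y; exact: S_bound.
- exact: jLf.
Qed.

Let S_le (k : R -> R) x : measurable_fun (setT : set R) k -> (forall z : R, `|k z| <= `|z|^-1) ->
  `|S k x| <= L * \int[mu]_y `|f y|.
Proof.
move=> mk kV; apply: (le_trans (Rintegral_norm (jS x mk kV))).
rewrite -Rintegral_scale; last exact: Rintegrable_norm.
by apply: Rintegral_le => //; [exact/Rintegrable_norm/jS|move=> y; exact: S_bound].
Qed.

Let measurable_S (k : R -> R) :
  measurable_fun (setT : set R) k -> measurable_fun (setT : set R) (S k).
Proof.
move=> mk; apply: (@measurable_Rintegral2 _ _ _ _ R mu
  (fun z : R * R => gam z.1 * (psi z.1 - psi z.2) * k (z.1 - z.2) * f z.2)).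
apply: measurable_funM; last exact: (measurable_snd_comp mf).
apply: measurable_funM; last exact: measurable_fun_comp_sub.
apply: measurable_funM; first exact: (measurable_fst_comp mgam).
apply: measurable_funB; [exact: (measurable_fst_comp mpsi)|exact: (measurable_snd_comp mpsi)].
Qed.

(** Write [phi x = gam x * psi x] and [psi x = psi y + (psi x - psi y)] under the integral; the
    factor [psi y] turns [f] into [g]. *)
Let phi_convol (k : R -> R) x :
  measurable_fun (setT : set R) k -> (forall z : R, `|k z| <= `|z|^-1) ->
  Rintegrable mu (fun y => k (x - y) * f y) ->
  Rintegrable mu (fun y => k (x - y) * g y) ->
  phi x * convol k f x = gam x * convol k g x + S k x.
Proof.
move=> mk kV jkf jkg; rewrite -!Rintegral_scale// -Rintegral_add; last exact: jS.
  by apply: eqT_Rintegral => y; rewrite -(gamE x) /g; ring.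
exact: RintegrableZl.
Qed.

Let cvg_cpoisson (z : R) : cpoisson e z @[e --> 0^'+] --> z^-1.
Proof.
have [->|z0] := eqVneq z 0.
  by rewrite invr0; under eq_fun do rewrite /cpoisson mul0r; exact: cvg_cst.
rewrite [X in _ --> X](_ : _ = z / (z ^+ 2 + 0 ^+ 2)); last by field.
apply: cvg_at_right_filter; apply: cvgM; first exact: cvg_cst.
apply: cvgV; first by rewrite expr0n addr0 expf_neq0.
by apply: cvgD; [exact: cvg_cst|exact: exprn_continuous].
Qed.

Let jk_f n x : Rintegrable mu (fun y => trunc_kernel n (x - y) * f y).
Proof.
have a0 : 0 < n.+1%:R^-1 :> R by rewrite invr_gt0.
have b0 : 0 < n.+1%:R :> R by [].
have := RintegrableB (Rintegrable_convol_cpoisson jf x a0) (Rintegrable_convol_cpoisson jf x b0).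
by apply: eq_Rintegrable => y; rewrite /trunc_kernel mulrBl.
Qed.

Let jk_g n x : Rintegrable mu (fun y => trunc_kernel n (x - y) * g y).
Proof. by apply: Rintegrable_convol => //; exact: Rintegrable2_trunc_kernel. Qed.

(** Licenses Fubini for the symmetrization. The splitting of [phi_convol] leaves [G x * g y] against
    an integrable kernel, plus a commutator term at most [L * |f x| * |f y|]. *)
Let prod_integrable n : Rintegrable mu2
  (fun z : R * R => phi z.1 * f z.1 * (trunc_kernel n (z.1 - z.2) * f z.2)).
Proof.
have mk := @measurable_trunc_kernel R n.
have jk := Rintegrable_norm (Rintegrable_trunc_kernel R n).
have mkk : measurable_fun setT (fun z : R * R => trunc_kernel n (z.1 - z.2)).
  exact: measurable_fun_comp_sub.
have mkn : measurable_fun setT (fun z : R * R => `|trunc_kernel n (z.1 - z.2)|).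
  exact: measurableT_comp.
pose N := \int[mu]_z `|trunc_kernel n z|.
have j1 : Rintegrable mu2 (fun z : R * R => G z.1 ^+ 2 * `|trunc_kernel n (z.1 - z.2)|).
  apply: (@Rintegrable_prod1 _ _ _ _ R mu mu _ (fun x => N * G x ^+ 2)) => /=.
  - by apply: measurable_funM => //; apply: measurable_funX; exact: (measurable_fst_comp G2.1).
  - by move=> x; apply: RintegrableZl; exact: (Rintegrable_reflect x jk).
  - move=> x; under eq_fun do rewrite (ger0_norm (mulr_ge0 (sqr_ge0 _) (normr_ge0 _))).
    rewrite Rintegral_scale; last exact: (Rintegrable_reflect x jk).
    by rewrite (Rintegral_reflect x jk) mulrC.
  - exact: (RintegrableZl _ G2.2).
have j2 : Rintegrable mu2 (fun z : R * R => g z.2 ^+ 2 * `|trunc_kernel n (z.1 - z.2)|).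
  apply: (@Rintegrable_prod2 _ _ _ _ R mu mu _ (fun x => N * g x ^+ 2)) => /=.
  - by apply: measurable_funM => //; apply: measurable_funX; exact: (measurable_snd_comp g2.1).
  - by move=> x; apply: RintegrableZl; exact: (Rintegrable_shift x jk).
  - move=> x; under eq_fun do rewrite (ger0_norm (mulr_ge0 (sqr_ge0 _) (normr_ge0 _))).
    rewrite Rintegral_scale; last exact: (Rintegrable_shift x jk).
    by rewrite (Rintegral_shift x jk) mulrC.
  - exact: (RintegrableZl _ g2.2).
have j3 : Rintegrable mu2 (fun z : R * R => `|f z.1| * (L * `|f z.2|)).
  exact: (Rintegrable_tensor (Rintegrable_norm jf) jLf).
apply: Rintegrable_le (RintegrableD (RintegrableD j1 j2) j3).
  apply: measurable_funM; apply: measurable_funM => //.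
  - exact: (measurable_fst_comp mphi).
  - exact: (measurable_fst_comp mf).
  - exact: (measurable_snd_comp mf).
move=> [x y] /=; set k := trunc_kernel n (x - y).
have -> : phi x * f x * (k * f y) = G x * g y * k +
    f x * (gam x * (psi x - psi y) * k * f y).
  by rewrite -(gamE x) /G /g; ring.
apply: (le_trans (ler_normD _ _)); apply: lerD.
  rewrite normrM -mulrDl ler_wpM2r//.
  have := sqr_ge0 (G x - g y); have := sqr_ge0 (G x + g y).
  rewrite ler_norml; nra.
by rewrite normrM ler_wpM2l//; apply: S_bound => z; exact: trunc_kernel_le_inv.
Qed.

Let kernel_bound (k : R -> R) (z : R * R) : (forall z, `|k z| <= `|z|^-1) ->
  `|(phi z.1 - phi z.2) * k (z.1 - z.2) * f z.1 * f z.2| <= L * `|f z.1| * `|f z.2|.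
Proof.
move=> kV; rewrite normrM ler_wpM2r// normrM ler_wpM2r// normrM.
have [->|xy] := eqVneq z.1 z.2; first by rewrite subrr normr0 mul0r.
apply: (@le_trans _ _ (L * `|z.1 - z.2| * `|z.1 - z.2|^-1)).
  by apply: ler_pM => //; exact: phi_lip.
by rewrite mulfK// normr_eq0 subr_eq0.
Qed.

Let jLff : Rintegrable mu2 (fun z : R * R => L * `|f z.1| * `|f z.2|).
Proof. exact: (Rintegrable_tensor jLf (Rintegrable_norm jf)). Qed.

Let measurable_kernel (k : R -> R) : measurable_fun (setT : set R) k ->
  measurable_fun setT (fun z : R * R => (phi z.1 - phi z.2) * k (z.1 - z.2) * f z.1 * f z.2).
Proof.
move=> mk; apply: measurable_funM; last exact: (measurable_snd_comp mf).
apply: measurable_funM; last exact: (measurable_fst_comp mf).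
apply: measurable_funM; last exact: measurable_fun_comp_sub.
apply: measurable_funB; [exact: (measurable_fst_comp mphi)|exact: (measurable_snd_comp mphi)].
Qed.

Lemma Rintegrable_commutator_kernel : Rintegrable mu2
  (fun z : R * R => (phi z.1 - phi z.2) / (z.1 - z.2) * f z.1 * f z.2).
Proof.
apply: Rintegrable_le jLff.
  by apply: measurable_kernel; exact: measurable_invr.
by move=> z; apply: (@kernel_bound (@GRing.inv R)) => t; rewrite normfV.
Qed.

(* Exchanging the two variables changes the sign of the odd kernel. *)
Let symmetrization n : \int[mu]_x (phi x * f x * convol (trunc_kernel n) f x) =
  2^-1 * \int[mu2]_z ((phi z.1 - phi z.2) * trunc_kernel n (z.1 - z.2) * f z.1 * f z.2).
Proof.
have j := prod_integrable n; have j' := Rintegrable_swap j.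
pose I := \int[mu]_x (phi x * f x * convol (trunc_kernel n) f x).
have E1 : \int[mu2]_z (phi z.1 * f z.1 * (trunc_kernel n (z.1 - z.2) * f z.2)) = I.
  rewrite -(Rfubini1 (m1 := mu) (m2 := mu) j); apply: eqT_Rintegral => x /=.
  by rewrite Rintegral_scale.
have E2 : \int[mu2]_z (phi z.2 * f z.2 * (trunc_kernel n (z.2 - z.1) * f z.1)) = I.
  rewrite -(Rfubini2 (m1 := mu) (m2 := mu) j'); apply: eqT_Rintegral => x /=.
  by rewrite Rintegral_scale.
rewrite -/I [LHS](_ : I = 2^-1 * (I + I)); last by field.
rewrite -{1}E1 -E2 -(Rintegral_add j j'); congr (_ * _).
apply: eqT_Rintegral => z /=.
have -> : trunc_kernel n (z.2 - z.1) = - trunc_kernel n (z.1 - z.2).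
  by rewrite -opprB /trunc_kernel !cpoissonN; ring.
by ring.
Qed.

Let cvg_symmetrization : \int[mu]_x (phi x * f x * convol (trunc_kernel n) f x) @[n --> \oo] -->
  2^-1 * \int[mu2]_z ((phi z.1 - phi z.2) / (z.1 - z.2) * f z.1 * f z.2).
Proof.
under eq_fun do rewrite symmetrization.
apply: cvgM; first exact: cvg_cst.
have [||||_ //] := @dominated_Rintegral _ _ R mu2
  (fun n z => (phi z.1 - phi z.2) * trunc_kernel n (z.1 - z.2) * f z.1 * f z.2)
  (fun z => (phi z.1 - phi z.2) / (z.1 - z.2) * f z.1 * f z.2)
  (fun z => L * `|f z.1| * `|f z.2|).
- by move=> n; apply: measurable_kernel; exact: measurable_trunc_kernel.
- move=> z; apply: cvgM; last exact: cvg_cst.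
  apply: cvgM; last exact: cvg_cst.
  by apply: cvgM; [exact: cvg_cst|exact: cvg_trunc_kernel].
- by move=> n z; apply: kernel_bound => t; exact: trunc_kernel_le_inv.
- exact: jLff.
Qed.

Lemma hilbert_commutator :
  Rintegrable mu (fun x => phi x * f x * hilbert f x) /\
  \int[mu]_x (phi x * f x * hilbert f x) =
  (2 * pi)^-1 * \int[mu2]_z ((phi z.1 - phi z.2) / (z.1 - z.2) * f z.1 * f z.2).
Proof.
have [h [h2 uh2 cuh]] := convol_trunc_kernel_limit g2.
have Vinv (z : R) : `|z^-1| <= `|z|^-1 by rewrite normfV.
have Vk n := @trunc_kernel_le_inv R n.
have mk n := @measurable_trunc_kernel R n.
have minv := @measurable_invr R.
(* Almost everywhere this will be [pi] times the wanted integrand. Being built from [h], it is a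
   limit of regularised integrands before anything is known about principal values. *)
pose Phi x := G x * h x + f x * S (@GRing.inv R) x.
have jfS (k : R -> R) : measurable_fun (setT : set R) k -> (forall z : R, `|k z| <= `|z|^-1) ->
    Rintegrable mu (fun x => f x * S k x).
  move=> mk' kV.
  apply: Rintegrable_le (RintegrableZr (L * \int[mu]_y `|f y|) (Rintegrable_norm jf)).
    by apply: measurable_funM => //; exact: measurable_S.
  by move=> x; rewrite normrM ler_wpM2l//; exact: S_le.
have jPhi : Rintegrable mu Phi.
  by apply: RintegrableD; [exact: Rintegrable2_mul|exact: jfS].
have lim1 : \int[mu]_x (phi x * f x * convol (trunc_kernel n) f x) @[n --> \oo] -->
    \int[mu]_x Phi x.
  have u2 n : Rintegrable2 mu (convol (trunc_kernel n) g).
    apply: Rintegrable2_convol => //; first exact: Rintegrable_trunc_kernel.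
    exact: Rintegrable2_trunc_kernel.
  have E n : \int[mu]_x (phi x * f x * convol (trunc_kernel n) f x) =
      \int[mu]_x (G x * convol (trunc_kernel n) g x) +
      \int[mu]_x (f x * S (trunc_kernel n) x).
    rewrite -Rintegral_add; [|exact: Rintegrable2_mul|exact: jfS].
    apply: eqT_Rintegral => x; rewrite (mulrC (phi x)) -mulrA.
    by rewrite (phi_convol (mk n) (Vk n) (jk_f n x) (jk_g n x)) /G; ring.
  under eq_fun do rewrite E.
  rewrite /Phi Rintegral_add; [|exact: Rintegrable2_mul|exact: jfS].
  apply: cvgD.
    apply/cvgrPdist_le => e e0.
    have /cvgrPdist_le /(_ _ e0)[N _ NP] := cvg_Rintegral_mul G2 uh2 cuh.
    exists N => // n Nn /=; have := NP n Nn; rewrite /= sub0r normrN ger0_norm; last first.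
      by apply: Rintegral_ge0 => y _; exact: normr_ge0.
    apply: le_trans; rewrite distrC -Rintegral_sub; [|exact: Rintegrable2_mul..].
    under eqT_Rintegral do rewrite -mulrBr.
    exact/Rintegral_norm/(Rintegrable2_mul G2 (uh2 n)).
  have [||||_ //] := @dominated_Rintegral _ _ R mu (fun n x => f x * S (trunc_kernel n) x)
    (fun x => f x * S (@GRing.inv R) x) (fun x => `|f x| * (L * \int[mu]_y `|f y|)).
  - by move=> n; exact: (Rintegrable_measurable (jfS _ (mk n) (Vk n))).
  - move=> x; apply: cvgM; first exact: cvg_cst.
    by apply: cvg_S => // z; exact: cvg_trunc_kernel.
  - by move=> n x; rewrite normrM ler_wpM2l//; exact: S_le.
  - exact/RintegrableZr/Rintegrable_norm.
have IPhi : \int[mu]_x Phi x = 2^-1 *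
    \int[mu2]_z ((phi z.1 - phi z.2) / (z.1 - z.2) * f z.1 * f z.2).
  exact: (cvg_unique _ lim1 cvg_symmetrization).
have jph x : Rintegrable mu (fun y => poisson 1 (x - y) * `|h y|).
  apply: Rintegrable2_mul; first exact: (Rintegrable2_reflect x (Rintegrable2_poisson ltr01)).
  split; first exact: (measurableT_comp _ h2.1).
  by apply: eq_Rintegrable h2.2 => y; rewrite real_normK ?num_real.
have aef : {ae mu, forall x, lebesgue_pt f x}.
  apply: ae_lebesgue_pt => //; have := Rintegrable_poisson_mul jf 0.
  by apply: eq_Rintegrable => y; rewrite sub0r poissonN.
have aeh : {ae mu, forall x, lebesgue_pt h x}.
  apply: ae_lebesgue_pt => //; first exact: h2.1.
  by have := jph 0; apply: eq_Rintegrable => y; rewrite sub0r poissonN.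
have pi0 : pi != 0 :> R by rewrite gt_eqF// pi_gt0.
have aeE : {ae mu, forall x, phi x * f x * hilbert f x = pi^-1 * Phi x}.
  have FF : Filter (nbhs (almost_everywhere mu)) by exact: ae_filter_ringOfSetsType.
  apply: filterS2 aef aeh => x fx hx.
  (* At a zero of [phi] both sides vanish, whatever value [lim] gives to the principal value
     there. *)
  have [p0|p0] := eqVneq (phi x) 0.
    have gx0 : gam x = 0 by rewrite /gam p0 mul0r.
    rewrite p0 /Phi /G gx0 !mul0r /S.
    under eqT_Rintegral do rewrite gx0 !mul0r.
    by rewrite /Rintegral integral0 mulr0 addr0 mulr0.
  have lim_g : convol (cpoisson e) g x @[e --> 0^'+] --> h x.
    have ch := cvg_convol_poisson h2.1 jph hx.
    have lim : pi^-1 * convol (poisson e) h x @[e --> 0^'+] --> h x.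
      by rewrite -[X in _ --> X](mulKf pi0); apply: cvgM => //; exact: cvg_cst.
    apply: cvg_trans lim; apply: near_eq_cvg; near=> e.
    have e0 : 0 < e by near: e; exact: nbhs_right_gt.
    by rewrite (convol_poisson_limit g2 x h2 uh2 cuh e0) mulKf.
  have lim_S : S (cpoisson e) x @[e --> 0^'+] --> S (@GRing.inv R) x.
    apply/cvg_at_rightP => u [u0 uc]; apply: cvg_S.
    - by move=> n; exact: measurable_cpoisson.
    - by move=> n z; exact: cpoisson_le_inv.
    - by move=> z; have /cvg_at_rightP cz := @cvg_cpoisson z; apply: cz.
  have lim_f : convol (cut_kernel e) f x @[e --> 0^'+] -->
      (gam x * h x + S (@GRing.inv R) x) / phi x.
    (* Compare first with [cpoisson e], where [phi_convol] can be divided by [phi x]; the passage to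
       the sharp cut-off costs a term tending to 0. *)
    have lim1f : (gam x * convol (cpoisson e) g x + S (cpoisson e) x) / phi x +
        (convol (cut_kernel e) f x - convol (cpoisson e) f x) @[e --> 0^'+] -->
        (gam x * h x + S (@GRing.inv R) x) / phi x + 0.
      apply: cvgD; last exact: cvg_cut_cpoisson.
      apply: cvgM; last exact: cvg_cst.
      by apply: cvgD => //; apply: cvgM => //; exact: cvg_cst.
    rewrite -[X in _ --> X]addr0; apply: cvg_trans lim1f.
    apply: near_eq_cvg; near=> e.
    have e0 : 0 < e by near: e; exact: nbhs_right_gt.
    rewrite -phi_convol.
    - by rewrite mulrC mulKf// addrC subrK.
    - exact: measurable_cpoisson.
    - by move=> z; exact: cpoisson_le_inv.
    - exact: Rintegrable_convol_cpoisson.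
    - by apply: Rintegrable_convol => //; exact: Rintegrable2_cpoisson.
  rewrite (hilbertE lim_f) /Phi /G; move: pi0; move: (pi : R) => P P0.
  by field; rewrite p0 P0.
have mH : measurable_fun (setT : set R) (fun x => phi x * f x * hilbert f x).
  by apply: measurable_funM; [exact: measurable_funM|exact: measurable_hilbert].
have jH : Rintegrable mu (fun x => phi x * f x * hilbert f x).
  exact: (@ae_eq_Rintegrable _ _ _ mu _ _ mH (RintegrableZl pi^-1 jPhi) aeE).
split => //.
rewrite (@ae_eq_Rintegral _ _ _ mu _ _ mH (Rintegrable_measurable (RintegrableZl pi^-1 jPhi)) aeE).
rewrite Rintegral_scale// IPhi mulrA; congr (_ * _).
by move: pi0; move: (pi : R) => P P0; field.
Unshelve. all: end_near. Qed.

End commutator.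

(** * Reduction of the theorem to the weighted L^2 setting *)

Unset Implicit Arguments.
Unset Printing Implicit Defensive.

Theorem proposition1p1 (R : realType) (phi : R -> R) (p q : R) (f : R -> R)
    (phi_lip : [lipschitz phi x | x in setT])
    (p_gt1 : 1 < p) (q_gt1 : 1 < q) (pq : p^-1 + q^-1 = 1)
    (fLp : f \in Lfun lebesgue_measure p%:E)
    (fL1 : f \in Lfun lebesgue_measure 1%:E)
    (phifLq : (fun x => phi x * f x) \in Lfun lebesgue_measure q%:E) :
  [/\ lebesgue_measure.-integrable setT
        (fun x => (phi x * f x * hilbert f x)%:E),
      (lebesgue_measure \x lebesgue_measure)%E.-integrable setT
        (fun z : R * R =>
           ((phi z.1 - phi z.2) / (z.1 - z.2) * f z.1 * f z.2)%:E) &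
      (\int[lebesgue_measure]_x (phi x * f x * hilbert f x)%:E =
       ((2 * pi)^-1)%:E *
         \int[lebesgue_measure]_y \int[lebesgue_measure]_x
           ((phi x - phi y) / (x - y) * f x * f y)%:E)%E ].
Proof.
pose mu := @lebesgue_measure R.
(* The Lipschitz condition supplies every constant greater than some [M]; [M + 1] is one of them. *)
have [M [_ /(_ (M + 1))]] := phi_lip.
rewrite ltrDl ltr01 => /(_ isT) lipM.
have lip x y : `|phi x - phi y| <= (M + 1) * `|x - y|.
  exact: (lipM (x, y)).
have mphi : measurable_fun (setT : set R) phi.
  apply: continuous_measurable_fun => x; apply/cvgrPdist_le => e e0.
  have M0 : 0 <= M + 1.
    by have := lip 1 0; rewrite subr0 normr1 mulr1; exact: le_trans.
  near=> y; apply: (le_trans (lip x y)).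
  (* [M + 1] may be 0, whereas [M + 2] is positive and can be divided by. *)
  apply: (@le_trans _ _ ((M + 2) * `|x - y|)); first by rewrite ler_wpM2r//; lra.
  rewrite -ler_pdivlMl; last by lra.
  near: y; apply: cvgr_dist_le => //; rewrite mulr_gt0// invr_gt0; lra.
have jf : Rintegrable mu f by exact/Lfun1_integrable.
have mf := Rintegrable_measurable jf.
have jphi : Rintegrable mu (fun x => `|phi x| * f x ^+ 2).
  have p0 : 0 < p by lra.
  have q0 : 0 < q by lra.
  have jp := Lfun_integrable (ltW p_gt1) fLp.
  have jq := Lfun_integrable (ltW q_gt1) phifLq.
  apply: (@Rintegrable_le _ _ _ mu _ (fun x => `|f x| `^ p * p^-1 + `|phi x * f x| `^ q * q^-1)).
  - by apply: measurable_funM; [exact: measurableT_comp|exact: measurable_funX].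
  - move=> x; rewrite (ger0_norm (mulr_ge0 (normr_ge0 _) (sqr_ge0 _))).
    rewrite -(ger0_norm (sqr_ge0 (f x))) normrX expr2 mulrA -normrM mulrC.
    exact: conjugate_powR.
  - by apply: RintegrableD; apply: RintegrableZr.
have [jH EH] := hilbert_commutator lip mphi jf jphi.
have jK := Rintegrable_commutator_kernel lip mphi jf.
split; [exact: jH|exact: jK|].
rewrite (Rintegral_EFin jH) EH EFinM; congr (_ * _)%E.
by rewrite -(Rintegral_EFin jK) -(integral21_prod_meas1 (m1 := mu) (m2 := mu) jK).
Unshelve. all: end_near. Qed.
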